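(* Let $f(z)$ be a meromorphic function defined on $\mathbb{C}\setminus\{z_k\}$ with discrete poles $z_k$, and let $\Omega_m$ be a simply connected set whose boundary $\partial\Omega_m$ does not pass through any poles of $f(z)$. Then, provided $z\in\Omega_m$ is not a pole of $f(z)$, $$f(z)=\sum_{z_k\in\Omega_m}\sum_{n=1}^{o_k}\frac{a_{-n}^{(k)}}{(z-z_k)^n}+g_m(z),$$ where $o_k$ is the degree (order) of the pole at $z_k$, $a_{-n}^{(k)}$ is the coefficient of $(z-z_k)^{-n}$ in the principal part of the Laurent expansion of $f$ about $z_k$, and $$g_m(z)=\frac{1}{2\pi i}\oint_{\partial\Omega_m}dw\,\frac{f(w)}{w-z}.$$ Furthermore, if $|z|<\max_{w\in\partial\Omega_m}|w|$, then $g_m(z)$ admits a power series expansion with coefficients which are independent of $z$, $$g_m(z)=\sum_{j=0}^\infty z^j\left(\frac{1}{2\pi i}\oint_{\partial\Omega_m}dw\,\frac{f(w)}{w^{j+1}}\right).$$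
   Context: Here $\Omega_m\subset\mathbb{C}$ is thought of as a region containing finitely many of the poles of $f$, and $m$ is only a label for the region. The symbol $\oint_{\partial\Omega_m}$ denotes the contour integral along the boundary of $\Omega_m$, traversed once counterclockwise.
   Formalization: The power series is proved under |z| < min |w| over the boundary instead of |z| < max |w|; with max it is false (f = 1, Ω the disc of radius 1 about 2, z = 2: g = 1 but all coefficients vanish). *)

(* Defs.v *)
From Stdlib Require Import Reals List.
From Coquelicot Require Import Coquelicot.
Open Scope R_scope.
Open Scope C_scope.

(** * Meromorphic functions

    A meromorphic function is a total function [C -> C] whose values at its
    poles are irrelevant. *)

(* [a n] stands for the coefficient a_{-n} of (w - p)^{-n}. *)
Definition principal_part (o : nat) (a : nat -> C) (p w : C) : C :=
  sum_n_m (G := C_AbelianMonoid) (fun n => a n / (w - p) ^ n) 1 o.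

(* The Laurent expansion of [f] about [p] is finite to the left, with leading
   term of order [o >= 1]; both [o] and [a 1], ..., [a o] are then unique. *)
Definition pole_data (f : C -> C) (p : C) (o : nat) (a : nat -> C) : Prop :=
  (1 <= o)%nat /\ a o <> 0 /\
  exists (b : nat -> C) (r : R), (0 < r)%R /\
    forall w : C, (0 < Cmod (w - p) < r)%R ->
      is_series (K := C_AbsRing) (V := C_NormedModule)
        (fun j => b j * (w - p) ^ j) (f w - principal_part o a p w).

Definition is_pole (f : C -> C) (p : C) : Prop :=
  exists (o : nat) (a : nat -> C), pole_data f p o a.

(* The first clause says that the set of poles has no accumulation point in C. *)
Definition meromorphic (f : C -> C) : Prop :=
  (forall z : C, locally' (T := C_UniformSpace) z (fun w => ~ is_pole f w)) /\
  (forall z : C, ~ is_pole f z ->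
     ex_derive (K := C_AbsRing) (V := C_NormedModule) f z).

(** * Plane sets *)

Definition boundary (D : C -> Prop) (w : C) : Prop :=
  forall eps : R, (0 < eps)%R ->
    (exists u : C, (Cmod (u - w) < eps)%R /\ D u) /\
    (exists u : C, (Cmod (u - w) < eps)%R /\ ~ D u).

Definition is_min_modulus (S : C -> Prop) (m : R) : Prop :=
  (exists w : C, S w /\ Cmod w = m) /\ (forall w : C, S w -> (m <= Cmod w)%R).

Definition continuous_path (u v : R) (gamma : R -> C) : Prop :=
  continuous_on (T := R_UniformSpace) (U := C_UniformSpace)
    (fun t => (u <= t <= v)%R) gamma.

Definition path_connected (D : C -> Prop) : Prop :=
  forall x y : C, D x -> D y ->
    exists gamma : R -> C, continuous_path 0 1 gamma /\
      (forall t : R, (0 <= t <= 1)%R -> D (gamma t)) /\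
      gamma 0%R = x /\ gamma 1%R = y.

Definition unit_square (q : R * R) : Prop :=
  (0 <= fst q <= 1)%R /\ (0 <= snd q <= 1)%R.

Definition null_homotopic (D : C -> Prop) (gamma : R -> C) : Prop :=
  exists H : R * R -> C,
    continuous_on (T := prod_UniformSpace R_UniformSpace R_UniformSpace)
      (U := C_UniformSpace) unit_square H /\
    (forall q, unit_square q -> D (H q)) /\
    (forall t : R, (0 <= t <= 1)%R ->
       H (0%R, t) = gamma t /\ H (1%R, t) = gamma 0%R) /\
    (forall s : R, (0 <= s <= 1)%R ->
       H (s, 0%R) = gamma 0%R /\ H (s, 1%R) = gamma 0%R).

Definition simply_connected (D : C -> Prop) : Prop :=
  path_connected D /\
  forall gamma : R -> C, continuous_path 0 1 gamma ->
    (forall t : R, (0 <= t <= 1)%R -> D (gamma t)) ->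
    gamma 0%R = gamma 1%R -> null_homotopic D gamma.

(** * Contour integrals *)

(* On each piece the derivative extends continuously to the closed piece, i.e.
   the path is C^1 there with one-sided derivatives at the end points. *)
Definition piecewise_C1 (gamma : R -> C) : Prop :=
  continuous_path 0 1 gamma /\
  exists (n : nat) (t : nat -> R), t O = 0%R /\ t n = 1%R /\
    forall i : nat, (i < n)%nat -> (t i < t (S i))%R /\
      exists d : R -> C, continuous_path (t i) (t (S i)) d /\
        forall s : R, (t i < s < t (S i))%R ->
          is_derive (K := R_AbsRing) (V := C_R_NormedModule) gamma s (d s).

(* The junk values at the finitely many break points of a piecewise C^1 path do
   not affect the integral below. *)
Definition path_derive (gamma : R -> C) (t : R) : C :=
  (Derive (fun s => Re (gamma s)) t, Derive (fun s => Im (gamma s)) t).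

Definition contour_integral (F : C -> C) (gamma : R -> C) : C :=
  RInt (V := C_R_CompleteNormedModule)
    (fun t => F (gamma t) * path_derive gamma t) 0 1.

Definition winding_number (gamma : R -> C) (z : C) : C :=
  / (2 * PI * Ci) * contour_integral (fun w => / (w - z)) gamma.

(* [gamma] runs once counterclockwise along the boundary of [D], in the sense
   in which Ahlfors says that a cycle bounds a region: its index is 1 about the
   points of [D] and 0 about the points off the closure of [D].  For a
   piecewise C^1 Jordan curve with interior [D] this is the positive
   orientation.  [gamma] need not be injective, so a slit disc, whose boundary
   traversal covers the slit twice, is allowed. *)
Definition bounds_ccw (gamma : R -> C) (D : C -> Prop) : Prop :=
  piecewise_C1 gamma /\ gamma 0%R = gamma 1%R /\
  (forall w : C, boundary D w <->
     exists t : R, (0 <= t <= 1)%R /\ gamma t = w) /\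
  (forall z : C, D z -> winding_number gamma z = 1) /\
  (forall z : C, ~ D z -> ~ boundary D z -> winding_number gamma z = 0).

Definition cauchy_transform (f : C -> C) (gamma : R -> C) (z : C) : C :=
  / (2 * PI * Ci) * contour_integral (fun w => f w / (w - z)) gamma.

Definition sum_over (F : C -> C) (ps : list C) : C :=
  fold_right Cplus 0 (map F ps).

(* Main.v *)
(* Subtracting the principal parts at the poles in Omega leaves a function h that
   is holomorphic near the closure of Omega, and the quotient
   k(w) = (h(w) - h(z)) / (w - z) extends continuously over its exceptional points
   z and p.  Goursat's lemma, with such points allowed, gives vanishing integrals
   of k along small rectangles.  On a fine square grid only the cells leaving the
   neighbourhood of the closure of Omega can have nonzero circulation; it is
   cancelled by subtracting multiples of 1 / (w - c), with c the centre of the cell.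
   What remains has a primitive near the closure, and the path has index 0 about
   each c, so the integral of k along the path vanishes.  The principal parts
   contribute nothing, by partial fractions, since the path has index 1 about both
   z and p.  The power series is the geometric series for 1 / (w - z), integrated
   term by term. *)
Require Import Defs.
From Stdlib Require Import Reals ZArith List Lra Lia Psatz Classical ClassicalEpsilon.
From Coquelicot Require Import Coquelicot.
Open Scope R_scope.
Open Scope C_scope.

(** All topological information enters through the index of the path, so Cauchy's theorem takes its
    homology form. The obstacle is that [k] is controlled only near the closure of Omega, while a
    primitive built on the grid sums over all edges leading to a node, including edges where [k] is
    arbitrary. Edge values are therefore abstract data [H], [V], tied to integrals of [k] only on
    edges near the closure. A correction by a multiple of 1 / (w - c) acts linearly on these data
    and alters one circulation at a time; once all circulations vanish, the potential is path
    independent, even across cells where [k] means nothing. At the exceptional points of Goursat's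
    lemma only continuity is required, so a removable singularity needs just a limit, and no Cauchy
    formula on discs has to come first. The grid is finite because Omega is bounded, and this too
    comes from the index: it is 1 on Omega and tends to zero at infinity. *)

Lemma Cmod_sub_sym (x y : C) : Cmod (x - y) = Cmod (y - x).
Proof. rewrite <- Cmod_opp; f_equal; ring. Qed.

Lemma Cmod_sub_ge (x y : C) : (Cmod x - Cmod y <= Cmod (x - y))%R.
Proof.
  assert (H := Cmod_triangle (x - y) y).
  replace (x - y + y) with x in H by ring. lra.
Qed.

Lemma Cmod_sub_le (x y : C) : (Cmod (x - y) <= Cmod x + Cmod y)%R.
Proof.
  rewrite <- (Cmod_opp y). apply Cmod_triangle.
Qed.

Lemma Cmod_le_abs (x y : R) : (Cmod (x, y) <= Rabs x + Rabs y)%R.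
Proof.
  replace ((x, y) : C) with (RtoC x + Ci * RtoC y).
  2: apply injective_projections; simpl; ring.
  eapply Rle_trans. apply Cmod_triangle.
  rewrite Cmod_mult, Cmod_Ci, !Cmod_R. lra.
Qed.

Lemma Cmod_ge_fst (z : C) : (Rabs (fst z) <= Cmod z)%R.
Proof. eapply Rle_trans. 2: apply Rmax_Cmod. apply Rmax_l. Qed.

Lemma Cmod_ge_snd (z : C) : (Rabs (snd z) <= Cmod z)%R.
Proof. eapply Rle_trans. 2: apply Rmax_Cmod. apply Rmax_r. Qed.

Lemma Cneq_sub (x y : C) : x <> y -> x - y <> 0.
Proof. intros H E. apply H. replace x with (x - y + y) by ring. rewrite E. ring. Qed.

Lemma Cmod_sub_pos (x y : C) : x <> y -> (0 < Cmod (x - y))%R.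
Proof. intros H. apply Cmod_gt_0. now apply Cneq_sub. Qed.

Lemma ball_norm_Cmod (x y : C) (d : R) :
  ball_norm (V := C_R_NormedModule) x d y <-> (Cmod (y - x) < d)%R.
Proof. rewrite (Cmod_norm (y - x)). reflexivity. Qed.

(** * Limits, continuity and derivatives in terms of the modulus *)

(** Stating limits with [Cmod] makes the choice among the equivalent uniform structures on [C]
    immaterial. The filter is arbitrary so that one limit algebra serves full and punctured
    neighbourhoods, real parameters and sequences. *)
Definition limC {T : Type} (F : (T -> Prop) -> Prop) (f : T -> C) (l : C) : Prop :=
  forall eps : R, (0 < eps)%R -> F (fun x => (Cmod (f x - l) < eps)%R).

Lemma limC_filterlim {T : Type} (F : (T -> Prop) -> Prop) {FF : Filter F} (f : T -> C) (l : C) :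
  limC F f l <-> filterlim f F (locally (T := C_UniformSpace) l).
Proof.
  split; intros H.
  - apply (filterlim_locally_ball_norm (K := R_AbsRing) (U := C_R_NormedModule) f l).
    intros eps. generalize (H eps (cond_pos eps)). apply filter_imp.
    intros x. apply ball_norm_Cmod.
  - intros eps He.
    generalize (proj1 (filterlim_locally_ball_norm (K := R_AbsRing) (U := C_R_NormedModule) f l)
                  H (mkposreal eps He)).
    apply filter_imp. intros x. apply ball_norm_Cmod.
Qed.

Section Limits.

Context {T : Type} {F : (T -> Prop) -> Prop} {FF : Filter F}.

Lemma limC_const (c : C) : limC F (fun _ => c) c.
Proof.
  intros eps He. apply filter_forall. intros _.
  replace (c - c) with (RtoC 0) by ring. now rewrite Cmod_0.
Qed.

Lemma limC_ext (f g : T -> C) (l : C) :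
  F (fun x => f x = g x) -> limC F f l -> limC F g l.
Proof.
  intros E H eps He. generalize (filter_and _ _ E (H eps He)).
  apply filter_imp. now intros x [<- Hx].
Qed.

Lemma limC_plus (f g : T -> C) (l m : C) :
  limC F f l -> limC F g m -> limC F (fun x => f x + g x) (l + m).
Proof.
  intros Hf Hg eps He.
  assert (He2 : (0 < eps / 2)%R) by lra.
  generalize (filter_and _ _ (Hf _ He2) (Hg _ He2)). apply filter_imp.
  intros x [H1 H2].
  replace (f x + g x - (l + m)) with ((f x - l) + (g x - m)) by ring.
  eapply Rle_lt_trans. apply Cmod_triangle. lra.
Qed.

Lemma limC_mult (f g : T -> C) (l m : C) :
  limC F f l -> limC F g m -> limC F (fun x => f x * g x) (l * m).
Proof.
  intros Hf Hg eps He.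
  set (M := (1 + Cmod l + Cmod m)%R).
  assert (HM : (0 < M)%R) by (unfold M; generalize (Cmod_ge_0 l) (Cmod_ge_0 m); lra).
  set (e := Rmin 1 (eps / M)).
  assert (He' : (0 < e)%R).
  { apply Rmin_case. lra. apply Rdiv_lt_0_compat; lra. }
  assert (He1 : (e <= 1)%R) by apply Rmin_l.
  assert (He2 : (e * M <= eps)%R).
  { apply Rle_trans with (eps / M * M)%R.
    apply Rmult_le_compat_r. lra. apply Rmin_r. right. field. lra. }
  generalize (filter_and _ _ (Hf _ He') (Hg _ He')). apply filter_imp.
  intros x [H1 H2].
  replace (f x * g x - l * m)
    with ((f x - l) * (g x - m) + (l * (g x - m) + (f x - l) * m)) by ring.
  eapply Rle_lt_trans. apply Cmod_triangle.
  eapply Rle_lt_trans. apply Rplus_le_compat_l, Cmod_triangle.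
  rewrite !Cmod_mult.
  generalize (Cmod_ge_0 l) (Cmod_ge_0 m) (Cmod_ge_0 (f x - l)) (Cmod_ge_0 (g x - m)).
  intros. unfold M in He2. nra.
Qed.

Lemma limC_inv (f : T -> C) (l : C) :
  l <> 0 -> limC F f l -> limC F (fun x => / f x) (/ l).
Proof.
  intros Hl Hf eps He.
  assert (Hl' := proj1 (Cmod_gt_0 l) Hl).
  set (e := Rmin (Cmod l / 2) (eps * (Cmod l * Cmod l / 2))).
  assert (He' : (0 < e)%R).
  { apply Rmin_case. lra. apply Rmult_lt_0_compat; nra. }
  generalize (Hf _ He'). apply filter_imp. intros x Hx.
  assert (H1 : (Cmod (f x - l) < Cmod l / 2)%R).
  { eapply Rlt_le_trans. exact Hx. apply Rmin_l. }
  assert (H2 : (Cmod (f x - l) < eps * (Cmod l * Cmod l / 2))%R).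
  { eapply Rlt_le_trans. exact Hx. apply Rmin_r. }
  assert (H3 : (Cmod l / 2 < Cmod (f x))%R).
  { assert (H := Cmod_sub_ge l (f x)). rewrite Cmod_sub_sym in H. lra. }
  assert (Hfx : f x <> 0) by (apply Cmod_gt_0; lra).
  replace (/ f x - / l) with (- (f x - l) * / (f x * l)) by (field; auto).
  rewrite Cmod_mult, Cmod_opp, Cmod_inv, Cmod_mult.
  2: now apply Cmult_neq_0.
  apply (Rmult_lt_reg_r (Cmod (f x) * Cmod l)). nra.
  rewrite Rmult_assoc, Rinv_l by nra.
  rewrite Rmult_1_r.
  eapply Rlt_le_trans. exact H2.
  apply Rmult_le_compat_l; nra.
Qed.

Lemma limC_opp (f : T -> C) (l : C) : limC F f l -> limC F (fun x => - f x) (- l).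
Proof.
  intros H. replace (- l) with (- (1) * l) by ring.
  apply limC_ext with (fun x => - (1) * f x).
  - apply filter_forall. intros x. ring.
  - apply limC_mult; [apply limC_const | exact H].
Qed.

Lemma limC_minus (f g : T -> C) (l m : C) :
  limC F f l -> limC F g m -> limC F (fun x => f x - g x) (l - m).
Proof. intros Hf Hg. apply limC_plus; [exact Hf | now apply limC_opp]. Qed.

Lemma limC_div (f g : T -> C) (l m : C) :
  m <> 0 -> limC F f l -> limC F g m -> limC F (fun x => f x / g x) (l / m).
Proof. intros Hm Hf Hg. apply limC_mult; [exact Hf | now apply limC_inv]. Qed.

Lemma limC_pow (f : T -> C) (l : C) (n : nat) :
  limC F f l -> limC F (fun x => f x ^ n) (l ^ n).
Proof.
  intros H. induction n as [|n IH].
  - exact (limC_const 1).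
  - apply (limC_mult f (fun x => f x ^ n) l (l ^ n)); assumption.
Qed.

End Limits.

Definition contC (k : C -> C) (w : C) : Prop :=
  limC (locally (T := C_UniformSpace) w) k (k w).

Definition contR (g : R -> C) (t : R) : Prop := limC (locally t) g (g t).

Lemma locally_Cmod (w : C) (P : C -> Prop) :
  locally (T := C_UniformSpace) w P <->
  exists d : R, (0 < d)%R /\ forall u : C, (Cmod (u - w) < d)%R -> P u.
Proof.
  split.
  - intros H.
    destruct (locally_norm_le_locally (K := R_AbsRing) (V := C_R_NormedModule) w _ H) as [d Hd].
    exists d. split. apply cond_pos. intros u Hu. now apply Hd, ball_norm_Cmod.
  - intros (d & Hd & H).
    apply (locally_le_locally_norm (K := R_AbsRing) (V := C_R_NormedModule) w P).
    exists (mkposreal d Hd). intros u Hu. now apply H, (proj1 (ball_norm_Cmod w u d)).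
Qed.

Lemma locally_R (t : R) (P : R -> Prop) :
  locally t P <-> exists d : R, (0 < d)%R /\ forall u : R, (Rabs (u - t) < d)%R -> P u.
Proof.
  split.
  - intros [d Hd]. exists d. split. apply cond_pos. intros u Hu. apply Hd. exact Hu.
  - intros (d & Hd & H). exists (mkposreal d Hd). intros u Hu. apply H. exact Hu.
Qed.

Lemma locally'_Cmod (w : C) (P : C -> Prop) :
  locally' (T := C_UniformSpace) w P <->
  exists d : R, (0 < d)%R /\ forall u : C, (0 < Cmod (u - w) < d)%R -> P u.
Proof.
  unfold locally', within. rewrite locally_Cmod. split.
  - intros (d & Hd & H). exists d. split. exact Hd. intros u [Hu1 Hu2].
    apply H. exact Hu2. intros ->. replace (w - w) with (RtoC 0) in Hu1 by ring.
    rewrite Cmod_0 in Hu1. lra.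
  - intros (d & Hd & H). exists d. split. exact Hd. intros u Hu Hn.
    apply H. split. now apply Cmod_sub_pos. exact Hu.
Qed.

Lemma limC_id (w : C) : limC (locally (T := C_UniformSpace) w) (fun u => u) w.
Proof. intros eps He. apply locally_Cmod. now exists eps. Qed.

Lemma limC_locally' (k : C -> C) (w l : C) :
  limC (locally (T := C_UniformSpace) w) k l -> limC (locally' (T := C_UniformSpace) w) k l.
Proof.
  intros H eps He. generalize (H eps He). unfold locally', within.
  apply filter_imp. auto.
Qed.

Lemma contC_of_punctured (k : C -> C) (w : C) :
  limC (locally' (T := C_UniformSpace) w) k (k w) -> contC k w.
Proof.
  intros H eps He. generalize (H eps He). unfold locally', within. apply filter_imp.
  intros u Hu. destruct (classic (u = w)) as [->|Hn]; [|auto].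
  replace (k w - k w) with (RtoC 0) by ring. now rewrite Cmod_0.
Qed.

Lemma contC_ext (k1 k2 : C -> C) (w : C) :
  locally (T := C_UniformSpace) w (fun u => k1 u = k2 u) -> contC k1 w -> contC k2 w.
Proof.
  intros E H. unfold contC. rewrite <- (locally_singleton w _ E).
  apply (limC_ext k1); assumption.
Qed.

Lemma contR_continuous (g : R -> C) (t : R) :
  contR g t <-> continuous (T := R_UniformSpace) (U := C_R_NormedModule) g t.
Proof. exact (limC_filterlim (locally t) g (g t)). Qed.

Lemma contR_minus (f g : R -> C) (t : R) :
  contR f t -> contR g t -> contR (fun s => f s - g s) t.
Proof. exact (limC_minus (F := locally t) f g (f t) (g t)). Qed.

Lemma contR_mult (f g : R -> C) (t : R) :
  contR f t -> contR g t -> contR (fun s => f s * g s) t.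
Proof. exact (limC_mult (F := locally t) f g (f t) (g t)). Qed.

Lemma limC_comp {T : Type} (F : (T -> Prop) -> Prop) (g : T -> C) (k : C -> C) (w : C) :
  Filter F -> limC F g w -> contC k w -> limC F (fun x => k (g x)) (k w).
Proof.
  intros FF Hg Hk eps He.
  destruct (proj1 (locally_Cmod _ _) (Hk eps He)) as (d & Hd & H).
  generalize (Hg d Hd). apply filter_imp. intros x Hx. now apply H.
Qed.

(** The division-free form makes sense at [w = z], composes with paths that may return to the same
    point, and is the affine approximation that Goursat's lemma uses. *)
Definition cderiv (f : C -> C) (z l : C) : Prop :=
  forall eps : R, (0 < eps)%R -> locally (T := C_UniformSpace) z
    (fun w => (Cmod (f w - f z - l * (w - z)) <= eps * Cmod (w - z))%R).

Lemma is_derive_cderiv (f : C -> C) (z l : C) :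
  is_derive (K := C_AbsRing) (V := C_NormedModule) f z l -> cderiv f z l.
Proof.
  intros [_ H] eps He.
  assert (Hz : is_filter_lim (T := AbsRing_UniformSpace C_AbsRing)
                 (locally (T := AbsRing_UniformSpace C_AbsRing) z) z) by (intros P HP; exact HP).
  specialize (H z Hz (mkposreal eps He)).
  destruct H as [d Hd]. apply locally_Cmod. exists d. split. apply cond_pos.
  intros w Hw. specialize (Hd w Hw). simpl in Hd.
  replace (f w - f z - l * (w - z)) with (f w - f z - (w - z) * l) by ring.
  exact Hd.
Qed.

Lemma cderiv_quotient (f : C -> C) (z l : C) :
  cderiv f z l -> limC (locally' (T := C_UniformSpace) z) (fun w => (f w - f z) / (w - z)) l.
Proof.
  intros H eps He.
  assert (He2 : (0 < eps / 2)%R) by lra.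
  generalize (H _ He2). unfold locally', within. apply filter_imp.
  intros w Hw Hn.
  assert (Hp := Cmod_sub_pos _ _ Hn).
  replace ((f w - f z) / (w - z) - l) with ((f w - f z - l * (w - z)) / (w - z)).
  2: field; now apply Cneq_sub.
  rewrite Cmod_div by now apply Cneq_sub.
  apply (Rmult_lt_reg_r (Cmod (w - z))). exact Hp.
  unfold Rdiv. rewrite Rmult_assoc, Rinv_l by lra. nra.
Qed.

(** Together with [cderiv_quotient] this lets the differentiation rules be read off from the limit
    algebra. *)
Lemma cderiv_of_quotient (f : C -> C) (z l : C) :
  limC (locally' (T := C_UniformSpace) z) (fun w => (f w - f z) / (w - z)) l -> cderiv f z l.
Proof.
  intros H eps He.
  generalize (H _ He). unfold locally', within. apply filter_imp.
  intros w Hw. destruct (classic (w = z)) as [->|Hn].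
  { replace (f z - f z - l * (z - z)) with (RtoC 0) by ring.
    replace (z - z) with (RtoC 0) by ring. rewrite Cmod_0. lra. }
  specialize (Hw Hn).
  replace (f w - f z - l * (w - z)) with (((f w - f z) / (w - z) - l) * (w - z)).
  2: field; now apply Cneq_sub.
  rewrite Cmod_mult. apply Rmult_le_compat_r. apply Cmod_ge_0. lra.
Qed.

Lemma cderiv_contC (f : C -> C) (z l : C) : cderiv f z l -> contC f z.
Proof.
  intros H. apply contC_of_punctured.
  apply cderiv_quotient in H.
  replace (f z) with (f z + l * (z - z)) by ring.
  apply limC_ext with (fun w => f z + (f w - f z) / (w - z) * (w - z)).
  { apply locally'_Cmod. exists 1%R. split. lra. intros u [Hu _].
    field. now apply Cmod_gt_0. }
  apply limC_plus. apply limC_const. apply limC_mult. exact H.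
  apply limC_minus. apply limC_locally', limC_id. apply limC_const.
Qed.

Lemma cderiv_ext (f g : C -> C) (z l : C) :
  locally (T := C_UniformSpace) z (fun w => f w = g w) -> cderiv f z l -> cderiv g z l.
Proof.
  intros E H eps He. rewrite <- (locally_singleton z _ E).
  generalize (filter_and _ _ E (H eps He)). apply filter_imp. now intros w [<- Hw].
Qed.

Lemma cderiv_const (c z : C) : cderiv (fun _ => c) z 0.
Proof.
  intros eps He. apply filter_forall. intros w.
  replace (c - c - 0 * (w - z)) with (RtoC 0) by ring. rewrite Cmod_0.
  apply Rmult_le_pos. lra. apply Cmod_ge_0.
Qed.

Lemma cderiv_id (z : C) : cderiv (fun w => w) z 1.
Proof.
  intros eps He. apply filter_forall. intros w.
  replace (w - z - 1 * (w - z)) with (RtoC 0) by ring. rewrite Cmod_0.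
  apply Rmult_le_pos. lra. apply Cmod_ge_0.
Qed.

Lemma locally'_neq (z : C) : locally' (T := C_UniformSpace) z (fun w => w - z <> 0).
Proof.
  apply locally'_Cmod. exists 1%R. split. lra. intros u [Hu _]. now apply Cmod_gt_0.
Qed.

Lemma cderiv_plus (f g : C -> C) (z l m : C) :
  cderiv f z l -> cderiv g z m -> cderiv (fun w => f w + g w) z (l + m).
Proof.
  intros Hf Hg. apply cderiv_of_quotient.
  apply limC_ext with (fun w => (f w - f z) / (w - z) + (g w - g z) / (w - z)).
  { generalize (locally'_neq z). apply filter_imp. intros w Hw. now field. }
  apply limC_plus; now apply cderiv_quotient.
Qed.

Lemma cderiv_mult (f g : C -> C) (z l m : C) :
  cderiv f z l -> cderiv g z m -> cderiv (fun w => f w * g w) z (l * g z + f z * m).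
Proof.
  intros Hf Hg. apply cderiv_of_quotient.
  apply limC_ext with
    (fun w => (f w - f z) / (w - z) * g w + f z * ((g w - g z) / (w - z))).
  { generalize (locally'_neq z). apply filter_imp. intros w Hw. now field. }
  apply limC_plus; apply limC_mult; try (now apply cderiv_quotient); try apply limC_const.
  now apply limC_locally', (cderiv_contC _ _ m).
Qed.

Lemma cderiv_inv (f : C -> C) (z l : C) :
  f z <> 0 -> cderiv f z l -> cderiv (fun w => / f w) z (- l * / (f z * f z)).
Proof.
  intros Hz Hf.
  assert (Hc : limC (locally' (T := C_UniformSpace) z) f (f z))
    by now apply limC_locally', (cderiv_contC _ _ l).
  apply cderiv_of_quotient.
  apply limC_ext with (fun w => - ((f w - f z) / (w - z)) * / (f w * f z)).
  { assert (Hp := proj1 (Cmod_gt_0 _) Hz).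
    generalize (filter_and _ _ (locally'_neq z) (Hc _ Hp)).
    apply filter_imp. intros w [Hw Hw'].
    assert (f w <> 0).
    { intros E. rewrite E in Hw'. replace (0 - f z) with (- f z) in Hw' by ring.
      rewrite Cmod_opp in Hw'. lra. }
    field. auto. }
  apply limC_mult. now apply limC_opp, cderiv_quotient.
  apply limC_inv. now apply Cmult_neq_0. apply limC_mult. exact Hc. apply limC_const.
Qed.

Lemma cderiv_pow (f : C -> C) (z l : C) (n : nat) :
  cderiv f z l -> cderiv (fun w => f w ^ S n) z (INR (S n) * f z ^ n * l).
Proof.
  intros Hf. induction n as [|n IH].
  - replace (INR 1 * f z ^ 0 * l) with l by (simpl; ring).
    apply cderiv_ext with (2 := Hf). apply filter_forall. intros w. simpl. ring.
  - replace (INR (S (S n)) * f z ^ S n * l)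
      with (l * f z ^ S n + f z * (INR (S n) * f z ^ n * l)).
    exact (cderiv_mult f (fun w => f w ^ S n) z _ _ Hf IH).
    rewrite (S_INR (S n)), RtoC_plus. simpl Cpow. ring.
Qed.

(** * Integrals of complex functions of a real variable *)

Notation CInt := (RInt (V := C_R_CompleteNormedModule)).
Notation ex_CInt := (ex_RInt (V := C_R_NormedModule)).
Notation is_CInt := (is_RInt (V := C_R_NormedModule)).

Lemma CInt_correct (f : R -> C) (a b : R) : ex_CInt f a b -> is_CInt f a b (CInt f a b).
Proof. exact (RInt_correct (V := C_R_CompleteNormedModule) f a b). Qed.

Lemma CInt_unique (f : R -> C) (a b : R) (l : C) : is_CInt f a b l -> CInt f a b = l.
Proof. exact (is_RInt_unique (V := C_R_CompleteNormedModule) f a b l). Qed.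

Lemma is_CInt_plus (f g : R -> C) (a b : R) (l m : C) :
  is_CInt f a b l -> is_CInt g a b m -> is_CInt (fun t => f t + g t) a b (l + m).
Proof. exact (is_RInt_plus (V := C_R_NormedModule) f g a b l m). Qed.

Lemma is_CInt_minus (f g : R -> C) (a b : R) (l m : C) :
  is_CInt f a b l -> is_CInt g a b m -> is_CInt (fun t => f t - g t) a b (l - m).
Proof. exact (is_RInt_minus (V := C_R_NormedModule) f g a b l m). Qed.

(** The integral is taken in a real vector space, where only real scalars act. Multiplication by [c]
    mixes real and imaginary parts, hence the passage to components. *)
Lemma is_CInt_scal (c : C) (f : R -> C) (a b : R) (l : C) :
  is_CInt f a b l -> is_CInt (fun t => c * f t) a b (c * l).
Proof.
  intros H.
  assert (H1 := is_RInt_fct_extend_fst (U := R_NormedModule) (V := R_NormedModule) f a b l H).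
  assert (H2 := is_RInt_fct_extend_snd (U := R_NormedModule) (V := R_NormedModule) f a b l H).
  apply (is_RInt_fct_extend_pair (U := R_NormedModule) (V := R_NormedModule)); simpl.
  - apply (is_RInt_minus (V := R_NormedModule)
             (fun t => scal (fst c) (fst (f t))) (fun t => scal (snd c) (snd (f t))));
      now apply (is_RInt_scal (V := R_NormedModule)).
  - apply (is_RInt_plus (V := R_NormedModule)
             (fun t => scal (fst c) (snd (f t))) (fun t => scal (snd c) (fst (f t))));
      now apply (is_RInt_scal (V := R_NormedModule)).
Qed.

Lemma is_CInt_ext (f g : R -> C) (a b : R) (l : C) :
  (forall t, (Rmin a b < t < Rmax a b)%R -> f t = g t) -> is_CInt f a b l -> is_CInt g a b l.
Proof. exact (is_RInt_ext (V := C_R_NormedModule) f g a b l). Qed.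

Lemma is_CInt_Chasles (f : R -> C) (a b c : R) (l m : C) :
  is_CInt f a b l -> is_CInt f b c m -> is_CInt f a c (l + m).
Proof. exact (is_RInt_Chasles (V := C_R_NormedModule) f a b c l m). Qed.

Lemma is_CInt_swap (f : R -> C) (a b : R) (l : C) :
  is_CInt f b a l -> is_CInt f a b (- l).
Proof. exact (is_RInt_swap (V := C_R_NormedModule) f a b l). Qed.

Lemma is_CInt_point (f : R -> C) (a : R) : is_CInt f a a (RtoC 0).
Proof. exact (is_RInt_point (V := C_R_NormedModule) f a). Qed.

Lemma is_CInt_const (c : C) (a b : R) : is_CInt (fun _ => c) a b (RtoC (b - a) * c).
Proof.
  replace (RtoC (b - a) * c) with (scal (V := C_R_NormedModule) (b - a)%R c).
  apply (is_RInt_const (V := C_R_NormedModule)).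
  apply injective_projections; simpl; unfold scal; simpl; unfold mult; simpl; ring.
Qed.

Lemma is_CInt_bound (f : R -> C) (a b M : R) (l : C) :
  (forall t, (Rmin a b <= t <= Rmax a b)%R -> (Cmod (f t) <= M)%R) ->
  is_CInt f a b l -> (Cmod l <= Rabs (b - a) * M)%R.
Proof.
  intros H Hl. rewrite Cmod_norm.
  apply (norm_RInt_le_const_abs (V := C_R_NormedModule) f a b l M); [|exact Hl].
  intros t Ht. rewrite <- Cmod_norm. now apply H.
Qed.

Lemma ex_CInt_cont (f : R -> C) (a b : R) :
  (forall t, (Rmin a b <= t <= Rmax a b)%R -> contR f t) -> ex_CInt f a b.
Proof.
  intros H. apply (ex_RInt_continuous (V := C_R_CompleteNormedModule)).
  intros t Ht. now apply contR_continuous, H.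
Qed.

Lemma CInt_plus (f g : R -> C) (a b : R) :
  ex_CInt f a b -> ex_CInt g a b -> CInt (fun t => f t + g t) a b = CInt f a b + CInt g a b.
Proof. intros Hf Hg. now apply CInt_unique, is_CInt_plus; apply CInt_correct. Qed.

Lemma CInt_minus (f g : R -> C) (a b : R) :
  ex_CInt f a b -> ex_CInt g a b -> CInt (fun t => f t - g t) a b = CInt f a b - CInt g a b.
Proof. intros Hf Hg. now apply CInt_unique, is_CInt_minus; apply CInt_correct. Qed.

Lemma CInt_scal (c : C) (f : R -> C) (a b : R) :
  ex_CInt f a b -> CInt (fun t => c * f t) a b = c * CInt f a b.
Proof. intros Hf. now apply CInt_unique, is_CInt_scal, CInt_correct. Qed.

Lemma CInt_Chasles (f : R -> C) (a b c : R) :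
  ex_CInt f a b -> ex_CInt f b c -> CInt f a c = CInt f a b + CInt f b c.
Proof. intros Hf Hg. now apply CInt_unique, (is_CInt_Chasles f a b c); apply CInt_correct. Qed.

Lemma CInt_swap (f : R -> C) (a b : R) : ex_CInt f a b -> CInt f b a = - CInt f a b.
Proof. intros Hf. now apply CInt_unique, is_CInt_swap, CInt_correct. Qed.

Lemma CInt_point (f : R -> C) (a : R) : CInt f a a = RtoC 0.
Proof. apply CInt_unique, is_CInt_point. Qed.

Lemma CInt_ext (f g : R -> C) (a b : R) :
  (forall t, (Rmin a b < t < Rmax a b)%R -> f t = g t) -> CInt f a b = CInt g a b.
Proof. exact (RInt_ext (V := C_R_CompleteNormedModule) f g a b). Qed.

Lemma CInt_bound (f : R -> C) (a b M : R) :
  ex_CInt f a b ->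
  (forall t, (Rmin a b <= t <= Rmax a b)%R -> (Cmod (f t) <= M)%R) ->
  (Cmod (CInt f a b) <= Rabs (b - a) * M)%R.
Proof. intros Hf H. eapply is_CInt_bound. exact H. now apply CInt_correct. Qed.

(** * Integrals over rectangles and Goursat's lemma *)

Definition hint (k : C -> C) (y a b : R) : C := CInt (fun x => k (x, y)) a b.
(** The factor i of dw = i dy is left out here; [rint], [lint] and [vedge] put it back. *)
Definition vint (k : C -> C) (x c d : R) : C := CInt (fun y => k (x, y)) c d.

(* The integral of [k] along the boundary of [[a, b] x [c, d]], counterclockwise
   when [a <= b] and [c <= d]. *)
Definition rint (k : C -> C) (a b c d : R) : C :=
  hint k c a b - hint k d a b + Ci * (vint k b c d - vint k a c d).

(** The corners may come in either order, because the end points of the paths in [lint] do. *)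
Definition rect (a b c d : R) (w : C) : Prop :=
  (Rmin a b <= fst w <= Rmax a b)%R /\ (Rmin c d <= snd w <= Rmax c d)%R.

Definition cont_on (k : C -> C) (S : C -> Prop) : Prop := forall w, S w -> contC k w.

(** Only rectangles whose inside also lies in [S] are tested, so the property says nothing about
    circulation around holes of [S]. *)
Definition cauchy_on (k : C -> C) (S : C -> Prop) : Prop :=
  forall a b c d : R, (a <= b)%R -> (c <= d)%R ->
    (forall w, rect a b c d w -> S w) -> rint k a b c d = 0.

Lemma limC_hline (x y : R) : limC (locally x) (fun t => (t, y) : C) (x, y).
Proof.
  intros eps He. apply locally_R. exists eps. split. exact He. intros u Hu.
  replace (_ - _) with (RtoC (u - x)).
  now rewrite Cmod_R. apply injective_projections; simpl; ring.
Qed.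

Lemma limC_vline (x y : R) : limC (locally y) (fun t => (x, t) : C) (x, y).
Proof.
  intros eps He. apply locally_R. exists eps. split. exact He. intros u Hu.
  replace (_ - _) with (Ci * RtoC (u - y)).
  rewrite Cmod_mult, Cmod_Ci, Cmod_R. lra.
  apply injective_projections; simpl; ring.
Qed.

Lemma contR_hline (k : C -> C) (x y : R) : contC k (x, y) -> contR (fun t => k (t, y)) x.
Proof.
  intros H. apply (limC_comp (locally x) (fun t => (t, y) : C) k (x, y)); auto.
  apply locally_filter. apply limC_hline.
Qed.

Lemma contR_vline (k : C -> C) (x y : R) : contC k (x, y) -> contR (fun t => k (x, t)) y.
Proof.
  intros H. apply (limC_comp (locally y) (fun t => (x, t) : C) k (x, y)); auto.
  apply locally_filter. apply limC_vline.
Qed.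

Lemma ex_hint (k : C -> C) (y a b : R) :
  (forall x, (Rmin a b <= x <= Rmax a b)%R -> contC k (x, y)) ->
  ex_CInt (fun x => k (x, y)) a b.
Proof. intros H. apply ex_CInt_cont. intros t Ht. now apply contR_hline, H. Qed.

Lemma ex_vint (k : C -> C) (x c d : R) :
  (forall y, (Rmin c d <= y <= Rmax c d)%R -> contC k (x, y)) ->
  ex_CInt (fun y => k (x, y)) c d.
Proof. intros H. apply ex_CInt_cont. intros t Ht. now apply contR_vline, H. Qed.

Ltac minmax := unfold rect in *; simpl fst in *; simpl snd in *;
  unfold Rmin, Rmax in *; repeat destruct Rle_dec; try lra.

Lemma rint_split_h (k : C -> C) (a m b c d : R) :
  (a <= m <= b)%R -> (c <= d)%R -> cont_on k (rect a b c d) ->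
  rint k a b c d = rint k a m c d + rint k m b c d.
Proof.
  intros Hm Hcd Hk. unfold rint, hint.
  rewrite (CInt_Chasles _ a m b), (CInt_Chasles _ a m b); try ring;
    apply ex_hint; intros; apply Hk; minmax.
Qed.

Lemma rint_split_v (k : C -> C) (a b c m d : R) :
  (a <= b)%R -> (c <= m <= d)%R -> cont_on k (rect a b c d) ->
  rint k a b c d = rint k a b c m + rint k a b m d.
Proof.
  intros Hab Hm Hk. unfold rint, vint.
  rewrite (CInt_Chasles _ c m d), (CInt_Chasles _ c m d); try ring;
    apply ex_vint; intros; apply Hk; minmax.
Qed.

Lemma rint_degenerate_h (k : C -> C) (a c d : R) : rint k a a c d = 0.
Proof. unfold rint, hint. rewrite !CInt_point. ring. Qed.

Lemma rint_degenerate_v (k : C -> C) (a b c : R) : rint k a b c c = 0.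
Proof. unfold rint, vint. rewrite !CInt_point. ring. Qed.

Lemma rint_bound (k : C -> C) (a b c d M : R) :
  (a <= b)%R -> (c <= d)%R -> cont_on k (rect a b c d) ->
  (forall w, rect a b c d w -> (Cmod (k w) <= M)%R) ->
  (Cmod (rint k a b c d) <= 2 * ((b - a) + (d - c)) * M)%R.
Proof.
  intros Hab Hcd Hk HM. unfold rint.
  assert (Hh : forall y, (c <= y <= d)%R -> (Cmod (hint k y a b) <= (b - a) * M)%R).
  { intros y Hy. rewrite <- (Rabs_pos_eq (b - a)) by lra. apply CInt_bound.
    apply ex_hint; intros; apply Hk; minmax.
    intros; apply HM; minmax. }
  assert (Hv : forall x, (a <= x <= b)%R -> (Cmod (vint k x c d) <= (d - c) * M)%R).
  { intros x Hx. rewrite <- (Rabs_pos_eq (d - c)) by lra. apply CInt_bound.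
    apply ex_vint; intros; apply Hk; minmax.
    intros; apply HM; minmax. }
  eapply Rle_trans. apply Cmod_triangle. rewrite Cmod_mult, Cmod_Ci.
  eapply Rle_trans. apply Rplus_le_compat. apply Cmod_sub_le.
  apply Rmult_le_compat_l. lra. apply Cmod_sub_le.
  generalize (Hh c) (Hh d) (Hv a) (Hv b). intros H1 H2 H3 H4.
  specialize (H1 ltac:(lra)). specialize (H2 ltac:(lra)).
  specialize (H3 ltac:(lra)). specialize (H4 ltac:(lra)). lra.
Qed.

Lemma hint_minus (k1 k2 : C -> C) (y a b : R) :
  (forall x, (Rmin a b <= x <= Rmax a b)%R -> contC k1 (x, y)) ->
  (forall x, (Rmin a b <= x <= Rmax a b)%R -> contC k2 (x, y)) ->
  hint (fun w => k1 w - k2 w) y a b = hint k1 y a b - hint k2 y a b.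
Proof.
  intros H1 H2.
  apply (CInt_minus (fun x => k1 (x, y)) (fun x => k2 (x, y))); now apply ex_hint.
Qed.

Lemma vint_minus (k1 k2 : C -> C) (x c d : R) :
  (forall y, (Rmin c d <= y <= Rmax c d)%R -> contC k1 (x, y)) ->
  (forall y, (Rmin c d <= y <= Rmax c d)%R -> contC k2 (x, y)) ->
  vint (fun w => k1 w - k2 w) x c d = vint k1 x c d - vint k2 x c d.
Proof.
  intros H1 H2.
  apply (CInt_minus (fun y => k1 (x, y)) (fun y => k2 (x, y))); now apply ex_vint.
Qed.

Lemma hint_scal (z : C) (k : C -> C) (y a b : R) :
  (forall x, (Rmin a b <= x <= Rmax a b)%R -> contC k (x, y)) ->
  hint (fun w => z * k w) y a b = z * hint k y a b.
Proof. intros H. apply (CInt_scal z (fun x => k (x, y))). now apply ex_hint. Qed.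

Lemma vint_scal (z : C) (k : C -> C) (x c d : R) :
  (forall y, (Rmin c d <= y <= Rmax c d)%R -> contC k (x, y)) ->
  vint (fun w => z * k w) x c d = z * vint k x c d.
Proof. intros H. apply (CInt_scal z (fun y => k (x, y))). now apply ex_vint. Qed.

Lemma rint_minus (k1 k2 : C -> C) (a b c d : R) :
  cont_on k1 (rect a b c d) -> cont_on k2 (rect a b c d) ->
  rint (fun w => k1 w - k2 w) a b c d = rint k1 a b c d - rint k2 a b c d.
Proof.
  intros H1 H2. unfold rint.
  rewrite 2!hint_minus, 2!vint_minus;
    try (intros; (apply H1 || apply H2); minmax). ring.
Qed.

Lemma rint_scal (z : C) (k : C -> C) (a b c d : R) :
  cont_on k (rect a b c d) -> rint (fun w => z * k w) a b c d = z * rint k a b c d.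
Proof.
  intros H. unfold rint. rewrite 2!hint_scal, 2!vint_scal; try (intros; apply H; minmax). ring.
Qed.

Lemma contC_const (z w : C) : contC (fun _ => z) w.
Proof. apply limC_const. Qed.

Lemma contC_affine (al be p w : C) : contC (fun w => al + be * (w - p)) w.
Proof.
  apply limC_plus. apply limC_const. apply limC_mult. apply limC_const.
  apply limC_minus. apply limC_id. apply limC_const.
Qed.

(** On opposite sides the values differ by a constant, i be (c - d) or be (b - a); multiplied by the
    lengths of the sides and by the factor i of the vertical ones, the two contributions cancel. *)
Lemma rint_affine (al be p : C) (a b c d : R) :
  rint (fun w => al + be * (w - p)) a b c d = 0.
Proof.
  set (k := fun w : C => al + be * (w - p)).
  assert (Hk : forall w, contC k w) by (intros w; apply contC_affine).
  assert (Hh : hint k c a b - hint k d a b = RtoC (b - a) * (be * (Ci * RtoC (c - d)))).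
  { unfold hint. rewrite <- CInt_minus by (apply ex_hint; auto).
    rewrite (CInt_ext _ (fun _ => be * (Ci * RtoC (c - d)))).
    apply CInt_unique, is_CInt_const.
    intros t _. apply injective_projections; simpl; ring. }
  assert (Hv : vint k b c d - vint k a c d = RtoC (d - c) * (be * RtoC (b - a))).
  { unfold vint. rewrite <- CInt_minus by (apply ex_vint; auto).
    rewrite (CInt_ext _ (fun _ => be * RtoC (b - a))).
    apply CInt_unique, is_CInt_const.
    intros t _. apply injective_projections; simpl; ring. }
  unfold rint. rewrite Hh, Hv, !RtoC_minus. ring.
Qed.

Lemma halving_limit (u : nat -> R) (del : R) :
  (forall n, u (S n) = (u n / 2)%R) -> (0 < del)%R -> exists n, (u n < del)%R.
Proof.
  intros Hu Hd.
  assert (E : forall n, u n = (u O * (/ 2) ^ n)%R).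
  { induction n as [|n IH]; simpl. ring. rewrite Hu, IH. field. }
  assert (Hp : (0 < del / (1 + Rabs (u O)))%R).
  { apply Rdiv_lt_0_compat. lra. generalize (Rabs_pos (u O)). lra. }
  destruct (pow_lt_1_zero (/ 2) ltac:(rewrite Rabs_pos_eq; lra) _ Hp) as [n Hn].
  exists n. specialize (Hn n (Nat.le_refl n)). rewrite E.
  assert (H0 := Rabs_pos (u O)). assert (H1 := Rle_abs (u O)).
  assert (Hq : (0 <= (/ 2) ^ n)%R) by (apply pow_le; lra).
  rewrite Rabs_pos_eq in Hn by exact Hq.
  apply (Rmult_lt_compat_r (1 + Rabs (u O))) in Hn; [|lra].
  unfold Rdiv in Hn. rewrite Rmult_assoc, Rinv_l in Hn by lra. nra.
Qed.

Lemma nested_point (a b : nat -> R) :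
  (forall n, (a n <= b n)%R) -> (forall n, (a n <= a (S n))%R) ->
  (forall n, (b (S n) <= b n)%R) -> exists x, forall n, (a n <= x <= b n)%R.
Proof.
  intros Hab Ha Hb.
  assert (Ha' : forall n m, (n <= m)%nat -> (a n <= a m)%R).
  { intros n m H. induction H. lra. eapply Rle_trans. exact IHle. apply Ha. }
  assert (Hb' : forall n m, (n <= m)%nat -> (b m <= b n)%R).
  { intros n m H. induction H. lra. eapply Rle_trans. apply Hb. exact IHle. }
  assert (Hx : forall n m, (a n <= b m)%R).
  { intros n m. apply Rle_trans with (a (Nat.max n m)). apply Ha'. lia.
    eapply Rle_trans. apply Hab. apply Hb'. lia. }
  destruct (completeness (fun r => exists n, r = a n)) as [x [H1 H2]].
  { exists (b O). intros r [n ->]. apply Hx. }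
  { now exists (a O), O. }
  exists x. intros n. split. apply H1. now exists n.
  apply H2. intros r [m ->]. apply Hx.
Qed.

(* Cousin's lemma for rectangles: repeated quartering. *)
Lemma rect_induction (P : R -> R -> R -> R -> Prop) (a0 b0 c0 d0 : R) :
  (a0 <= b0)%R -> (c0 <= d0)%R ->
  (forall a b c d, (a0 <= a <= b)%R -> (b <= b0)%R -> (c0 <= c <= d)%R -> (d <= d0)%R ->
     P a ((a + b) / 2)%R c ((c + d) / 2)%R -> P ((a + b) / 2)%R b c ((c + d) / 2)%R ->
     P a ((a + b) / 2)%R ((c + d) / 2)%R d -> P ((a + b) / 2)%R b ((c + d) / 2)%R d ->
     P a b c d) ->
  (forall x y, (a0 <= x <= b0)%R -> (c0 <= y <= d0)%R ->
     exists del, (0 < del)%R /\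
       forall a b c d, (a0 <= a)%R -> (b <= b0)%R -> (c0 <= c)%R -> (d <= d0)%R ->
         (a <= x <= b)%R -> (c <= y <= d)%R -> (b - a < del)%R -> (d - c < del)%R ->
         P a b c d) ->
  P a0 b0 c0 d0.
Proof.
  intros Hab Hcd Hsplit Hloc. apply NNPP. intros Hn.
  set (Bad := fun q : (R * R) * (R * R) =>
    let '((a, b), (c, d)) := q in
    (a0 <= a <= b)%R /\ (b <= b0)%R /\ (c0 <= c <= d)%R /\ (d <= d0)%R /\ ~ P a b c d).
  (* If all four quarters satisfied [P], so would the rectangle. Hence a bad rectangle has a bad
     quarter, and choice on the subtype of bad rectangles iterates this. *)
  assert (step : forall q : {q | Bad q}, exists q' : {q | Bad q},
    let '((a, b), (c, d)) := proj1_sig q in let '((a', b'), (c', d')) := proj1_sig q' in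
    (a <= a')%R /\ (b' <= b)%R /\ (c <= c')%R /\ (d' <= d)%R /\
    (b' - a' = (b - a) / 2)%R /\ (d' - c' = (d - c) / 2)%R).
  { intros [[[a b] [c d]] HB]. simpl. destruct HB as (H1 & H2 & H3 & H4 & H5).
    assert (HQ : exists a' b' c' d', Bad ((a', b'), (c', d')) /\
      (a <= a')%R /\ (b' <= b)%R /\ (c <= c')%R /\ (d' <= d)%R /\
      (b' - a' = (b - a) / 2)%R /\ (d' - c' = (d - c) / 2)%R).
    { apply NNPP. intros HN. apply H5.
      apply Hsplit; try lra; apply NNPP; intros HP; apply HN;
        do 4 eexists; (split; [unfold Bad; repeat split; [..| exact HP] | ]); lra. }
    destruct HQ as (a' & b' & c' & d' & HB & H).
    exists (exist _ ((a', b'), (c', d')) HB). exact H. }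
  set (next := fun q => proj1_sig (constructive_indefinite_description _ (step q))).
  assert (Hnext : forall q, let '((a, b), (c, d)) := proj1_sig q in
    let '((a', b'), (c', d')) := proj1_sig (next q) in
    (a <= a')%R /\ (b' <= b)%R /\ (c <= c')%R /\ (d' <= d)%R /\
    (b' - a' = (b - a) / 2)%R /\ (d' - c' = (d - c) / 2)%R)
    by (intros q; exact (proj2_sig (constructive_indefinite_description _ (step q)))).
  assert (H0 : Bad ((a0, b0), (c0, d0))) by (unfold Bad; repeat split; [lra .. | exact Hn]).
  set (s := fix s n := match n with O => exist Bad _ H0 | S n => next (s n) end).
  set (a := fun n => fst (fst (proj1_sig (s n)))). set (b := fun n => snd (fst (proj1_sig (s n)))).
  set (c := fun n => fst (snd (proj1_sig (s n)))). set (d := fun n => snd (snd (proj1_sig (s n)))).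
  assert (HB : forall n, (a0 <= a n <= b n)%R /\ (b n <= b0)%R /\ (c0 <= c n <= d n)%R /\
    (d n <= d0)%R /\ ~ P (a n) (b n) (c n) (d n)).
  { intros n. unfold a, b, c, d. destruct (s n) as [[[? ?] [? ?]] HBn]. exact HBn. }
  assert (HS : forall n, (a n <= a (S n))%R /\ (b (S n) <= b n)%R /\ (c n <= c (S n))%R /\
    (d (S n) <= d n)%R /\ (b (S n) - a (S n) = (b n - a n) / 2)%R /\
    (d (S n) - c (S n) = (d n - c n) / 2)%R).
  { intros n. generalize (Hnext (s n)). unfold a, b, c, d. simpl.
    destruct (proj1_sig (s n)) as [[? ?] [? ?]].
    destruct (proj1_sig (next (s n))) as [[? ?] [? ?]]. auto. }
  destruct (nested_point a b) as [x Hx]; try (intros n; now apply HB || apply HS).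
  destruct (nested_point c d) as [y Hy]; try (intros n; now apply HB || apply HS).
  destruct (Hloc x y) as (del & Hdel & HP); [exact (Hx O) | exact (Hy O) |].
  (* The sum of the two side lengths is halved at each stage, so both fall below [del] together. *)
  destruct (halving_limit (fun n => (b n - a n) + (d n - c n))%R del) as [n Hn'].
  { intros n. destruct (HS n) as (_ & _ & _ & _ & E1 & E2). rewrite E1, E2. field. }
  { exact Hdel. }
  destruct (HB n) as (H1 & H2 & H3 & H4 & H5). apply H5.
  apply HP; try lra; auto.
Qed.

Lemma Cmod_rect (a b c d : R) (p w : C) :
  (a <= b)%R -> (c <= d)%R -> rect a b c d p -> rect a b c d w ->
  (Cmod (w - p) <= (b - a) + (d - c))%R.
Proof.
  intros Hab Hcd Hp Hw. destruct w as [w1 w2], p as [p1 p2].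
  unfold rect in *. simpl in Hp, Hw.
  rewrite Rmin_left, Rmax_right, Rmin_left, Rmax_right in Hp, Hw by lra.
  eapply Rle_trans. apply (Cmod_le_abs (w1 - p1) (w2 - p2)).
  apply Rplus_le_compat; apply Rabs_le; lra.
Qed.

(** The bound eps times the squared half-perimeter survives quartering, since the four quarters have
    half the half-perimeter and four times a quarter is one. On small rectangles it holds because
    the affine part of [k] has zero integral. *)
Lemma goursat (k : C -> C) (S : C -> Prop) :
  (forall w, S w -> exists l, cderiv k w l) -> cauchy_on k S.
Proof.
  intros Hk a0 b0 c0 d0 Hab Hcd HS.
  assert (Hc : cont_on k (rect a0 b0 c0 d0)).
  { intros w Hw. destruct (Hk w (HS w Hw)) as [l Hl]. exact (cderiv_contC _ _ _ Hl). }
  apply Cmod_eq_0.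
  assert (H : forall eps, (0 < eps)%R ->
    (Cmod (rint k a0 b0 c0 d0) <= eps * (((b0 - a0) + (d0 - c0)) ^ 2))%R).
  { intros eps He.
    apply (rect_induction (fun a b c d =>
      (Cmod (rint k a b c d) <= eps * (((b - a) + (d - c)) ^ 2))%R) a0 b0 c0 d0 Hab Hcd).
    - intros a b c d H1 H2 H3 H4 Q1 Q2 Q3 Q4.
      assert (Hsub : forall a' b' c' d', (a0 <= a')%R -> (a' <= b')%R -> (b' <= b0)%R ->
        (c0 <= c')%R -> (c' <= d')%R -> (d' <= d0)%R -> cont_on k (rect a' b' c' d')).
      { intros. intros w Hw. apply Hc. minmax. }
      rewrite (rint_split_h k a ((a + b) / 2) b c d) by (try apply Hsub; lra).
      rewrite (rint_split_v k a ((a + b) / 2) c ((c + d) / 2) d) by (try apply Hsub; lra).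
      rewrite (rint_split_v k ((a + b) / 2) b c ((c + d) / 2) d) by (try apply Hsub; lra).
      eapply Rle_trans. apply Cmod_triangle.
      eapply Rle_trans. apply Rplus_le_compat; apply Cmod_triangle. nra.
    - intros x y Hx Hy.
      assert (Hp : rect a0 b0 c0 d0 (x, y)) by minmax.
      destruct (Hk _ (HS _ Hp)) as [l Hl].
      assert (He2 : (0 < eps / 2)%R) by lra.
      assert (Hl2 := Hl _ He2). rewrite locally_Cmod in Hl2.
      destruct Hl2 as (del & Hdel & Hest).
      exists (del / 2)%R. split. lra.
      intros a b c d Ha Hb Hc' Hd Hax Hcy Hlen1 Hlen2.
      set (s := ((b - a) + (d - c))%R).
      set (g := fun w => k (x, y) + l * (w - (x, y))).
      assert (Hck : cont_on k (rect a b c d)) by (intros w Hw; apply Hc; minmax).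
      assert (Hcg : cont_on g (rect a b c d)) by (intros w _; apply contC_affine).
      assert (E : rint k a b c d = rint (fun w => k w - g w) a b c d).
      { rewrite rint_minus by assumption. unfold g. rewrite rint_affine. ring. }
      rewrite E.
      (* Perimeter [2 * s] times the error [eps / 2 * s] of the affine approximation. *)
      apply Rle_trans with (2 * s * (eps / 2 * s))%R.
      2: right; unfold s; field.
      apply rint_bound; try lra.
      + intros w Hw. apply limC_minus; [now apply Hck | now apply Hcg].
      + intros w Hw.
        assert (Hwp : (Cmod (w - (x, y)) <= s)%R).
        { apply Cmod_rect; try lra; [minmax | exact Hw]. }
        replace (k w - g w) with (k w - k (x, y) - l * (w - (x, y))) by (unfold g; ring).
        eapply Rle_trans. apply Hest. unfold s in Hwp; lra.
        apply Rmult_le_compat_l. lra. exact Hwp. }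
  assert (H0 := Cmod_ge_0 (rint k a0 b0 c0 d0)).
  set (s := (((b0 - a0) + (d0 - c0)) ^ 2)%R) in H.
  assert (Hs : (0 <= s)%R) by (unfold s; nra).
  destruct (Rle_lt_or_eq_dec _ _ H0) as [Hlt|Heq]; [|now rewrite <- Heq].
  exfalso.
  (* With this epsilon the bound is less than half of the integral itself; the summand 1 covers
     [s = 0]. *)
  assert (Hq : (0 < Cmod (rint k a0 b0 c0 d0) / (2 * (1 + s)))%R).
  { apply Rdiv_lt_0_compat; lra. }
  specialize (H _ Hq).
  apply (Rmult_le_compat_r (2 * (1 + s))) in H; [|lra].
  replace (Cmod (rint k a0 b0 c0 d0) / (2 * (1 + s)) * s * (2 * (1 + s)))%R
    with (Cmod (rint k a0 b0 c0 d0) * s)%R in H by (field; lra).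
  nra.
Qed.

(** Cutting out a small rectangle around [p] leaves four rectangles that avoid [p], and the integral
    around the small one is at most its perimeter times a local bound of [k], hence arbitrarily
    small. *)
Lemma cauchy_on_remove_point (k : C -> C) (S : C -> Prop) (p : C) :
  cont_on k S -> cauchy_on k (fun w => S w /\ w <> p) -> cauchy_on k S.
Proof.
  intros Hk Hz a b c d Hab Hcd HS.
  destruct (classic (rect a b c d p)) as [Hp|Hp].
  2:{ apply Hz; auto. intros w Hw. split. now apply HS. intros ->. now apply Hp. }
  destruct p as [x y].
  assert (Hpc : contC k (x, y)) by now apply Hk, HS.
  assert (Hpc1 := Hpc 1%R Rlt_0_1). rewrite locally_Cmod in Hpc1.
  destruct Hpc1 as (del & Hdel & Hbd).
  set (M := (Cmod (k (x, y)) + 1)%R).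
  assert (HM : (0 < M)%R) by (unfold M; generalize (Cmod_ge_0 (k (x, y))); lra).
  assert (Hxy : (a <= x <= b)%R /\ (c <= y <= d)%R) by minmax.
  destruct Hxy as [Hx Hy].
  apply Cmod_eq_0, Rle_antisym; [|apply Cmod_ge_0].
  apply Rnot_lt_le. intros Hpos.
  set (J := Cmod (rint k a b c d)) in *.
  (* The small rectangle has sides at most [2 * e]. The first bound keeps it in the disc where [M]
     bounds [k]; the second makes its integral at most [8 * e * M], that is half of [J]. *)
  set (e := Rmin (del / 8) (J / (16 * M))).
  assert (He : (0 < e)%R).
  { apply Rmin_case. lra. apply Rdiv_lt_0_compat; lra. }
  assert (He1 : (e <= del / 8)%R) by apply Rmin_l.
  assert (He2 : (16 * M * e <= J)%R).
  { apply Rle_trans with (16 * M * (J / (16 * M)))%R.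
    apply Rmult_le_compat_l. lra. apply Rmin_r. right. field. lra. }
  (* Near or on a side of the rectangle, [p] leaves no room for a strip on that side. Then [x1 = a]
     and the strip is degenerate; otherwise it stays strictly away from [p]. The other three sides
     are alike. *)
  assert (Hl : exists x1, (a <= x1 <= x)%R /\ (x - e <= x1)%R /\ (x1 = a \/ x1 < x)%R).
  { destruct (Rle_dec a (x - e)). exists (x - e)%R; lra. exists a; lra. }
  assert (Hr : exists x2, (x <= x2 <= b)%R /\ (x2 <= x + e)%R /\ (x2 = b \/ x < x2)%R).
  { destruct (Rle_dec (x + e) b). exists (x + e)%R; lra. exists b; lra. }
  assert (Hd : exists y1, (c <= y1 <= y)%R /\ (y - e <= y1)%R /\ (y1 = c \/ y1 < y)%R).
  { destruct (Rle_dec c (y - e)). exists (y - e)%R; lra. exists c; lra. }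
  assert (Hu : exists y2, (y <= y2 <= d)%R /\ (y2 <= y + e)%R /\ (y2 = d \/ y < y2)%R).
  { destruct (Rle_dec (y + e) d). exists (y + e)%R; lra. exists d; lra. }
  destruct Hl as (x1 & Hx1 & Hx1' & Hx1''), Hr as (x2 & Hx2 & Hx2' & Hx2'').
  destruct Hd as (y1 & Hy1 & Hy1' & Hy1''), Hu as (y2 & Hy2 & Hy2' & Hy2'').
  assert (Hsub : forall a' b' c' d', (a <= a')%R -> (a' <= b')%R -> (b' <= b)%R ->
        (c <= c')%R -> (c' <= d')%R -> (d' <= d)%R -> cont_on k (rect a' b' c' d')).
  { intros. intros w Hw. apply Hk, HS. minmax. }
  assert (Hzero : forall a' b' c' d', (a <= a')%R -> (a' <= b')%R -> (b' <= b)%R ->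
        (c <= c')%R -> (c' <= d')%R -> (d' <= d)%R ->
        (b' < x \/ x < a' \/ d' < y \/ y < c')%R -> rint k a' b' c' d' = 0).
  { intros. apply Hz; auto. intros w Hw. split. apply HS. minmax.
    intros ->. minmax. }
  assert (E : rint k a b c d = rint k x1 x2 y1 y2).
  { rewrite (rint_split_h k a x1 b c d) by (try apply Hsub; lra).
    rewrite (rint_split_h k x1 x2 b c d) by (try apply Hsub; lra).
    rewrite (rint_split_v k x1 x2 c y1 d) by (try apply Hsub; lra).
    rewrite (rint_split_v k x1 x2 y1 y2 d) by (try apply Hsub; lra).
    assert (Z1 : rint k a x1 c d = 0).
    { destruct Hx1'' as [->|]. apply rint_degenerate_h. apply Hzero; lra. }
    assert (Z2 : rint k x2 b c d = 0).
    { destruct Hx2'' as [->|]. apply rint_degenerate_h. apply Hzero; lra. }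
    assert (Z3 : rint k x1 x2 c y1 = 0).
    { destruct Hy1'' as [->|]. apply rint_degenerate_v. apply Hzero; lra. }
    assert (Z4 : rint k x1 x2 y2 d = 0).
    { destruct Hy2'' as [->|]. apply rint_degenerate_v. apply Hzero; lra. }
    rewrite Z1, Z2, Z3, Z4. ring. }
  assert (HJ : (J <= 2 * ((x2 - x1) + (y2 - y1)) * M)%R).
  { unfold J. rewrite E. apply rint_bound; try lra. apply Hsub; lra.
    intros w Hw.
    assert (Hwp : (Cmod (w - (x, y)) <= (x2 - x1) + (y2 - y1))%R).
    { apply Cmod_rect; try lra; [minmax | exact Hw]. }
    specialize (Hbd w ltac:(lra)).
    generalize (Cmod_sub_ge (k w) (k (x, y))). unfold M. lra. }
  nra.
Qed.

Lemma cauchy_on_remove_points (k : C -> C) (S : C -> Prop) (l : list C) :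
  cont_on k S -> cauchy_on k (fun w => S w /\ ~ In w l) -> cauchy_on k S.
Proof.
  revert S. induction l as [|p l IH]; intros S Hk H.
  - intros a b c d Hab Hcd HS. apply H; [assumption .. |].
    intros w Hw. split. now apply HS. intros [].
  - apply (cauchy_on_remove_point k S p Hk), (IH (fun w => S w /\ w <> p)).
    + intros w [Hw _]. now apply Hk.
    + intros a b c d Hab Hcd HS. apply H; [assumption .. |]. intros w Hw.
      destruct (HS w Hw) as [[H1 H2] H3]. split. exact H1. intros [E|Hin]; auto.
Qed.

Lemma rint_swap_h (k : C -> C) (a b c d : R) :
  cont_on k (rect a b c d) -> rint k b a c d = - rint k a b c d.
Proof.
  intros Hk. unfold rint, hint.
  rewrite (CInt_swap _ a b), (CInt_swap (fun x => k (x, d)) a b); try ring;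
    apply ex_hint; intros; apply Hk; minmax.
Qed.

Lemma rint_swap_v (k : C -> C) (a b c d : R) :
  cont_on k (rect a b c d) -> rint k a b d c = - rint k a b c d.
Proof.
  intros Hk. unfold rint, vint.
  rewrite (CInt_swap _ c d), (CInt_swap (fun y => k (a, y)) c d); try ring;
    apply ex_vint; intros; apply Hk; minmax.
Qed.

Lemma cauchy_on_unordered (k : C -> C) (S : C -> Prop) (a b c d : R) :
  cont_on k S -> cauchy_on k S -> (forall w, rect a b c d w -> S w) -> rint k a b c d = 0.
Proof.
  intros Hk Hz HS.
  assert (E : rint k (Rmin a b) (Rmax a b) (Rmin c d) (Rmax c d) = 0).
  { apply Hz; try apply Rminmax. intros w Hw. apply HS. minmax. }
  assert (Hc : cont_on k (rect a b c d)) by (intros w Hw; apply Hk, HS, Hw).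
  assert (Hc' : cont_on k (rect b a c d)) by (intros w Hw; apply Hk, HS; minmax).
  destruct (Rle_dec a b) as [H1|H1], (Rle_dec c d) as [H2|H2].
  - now rewrite Rmin_left, Rmax_right, Rmin_left, Rmax_right in E by lra.
  - rewrite Rmin_left, Rmax_right, Rmin_right, Rmax_left in E by lra.
    rewrite rint_swap_v in E by assumption.
    replace (rint k a b c d) with (- - rint k a b c d) by ring. rewrite E. ring.
  - rewrite Rmin_right, Rmax_left, Rmin_left, Rmax_right in E by lra.
    rewrite rint_swap_h in E by assumption.
    replace (rint k a b c d) with (- - rint k a b c d) by ring. rewrite E. ring.
  - rewrite Rmin_right, Rmax_left, Rmin_right, Rmax_left in E by lra.
    rewrite rint_swap_v, rint_swap_h in E by assumption.
    rewrite <- E. ring.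
Qed.

(** * Primitives in squares *)

Definition box (p : C) (r : R) (w : C) : Prop :=
  (Rabs (fst w - fst p) < r)%R /\ (Rabs (snd w - snd p) < r)%R.

(** This is the integral along the L-shaped path from [p] to [q], horizontal leg first. *)
Definition lint (k : C -> C) (p q : C) : C :=
  hint k (snd p) (fst p) (fst q) + Ci * vint k (fst q) (snd p) (snd q).

Lemma Rabs_lt_iff (x r : R) : (Rabs x < r)%R <-> (- r < x < r)%R.
Proof.
  split. intros H. apply Rabs_def2 in H. lra. intros [? ?]. now apply Rabs_def1.
Qed.

(** The broken paths differ by the boundary of a single rectangle, spanned by the abscissas of [q]
    and [s] and the ordinates of [p] and [q]. It lies in the box because a box is a product of
    intervals. *)
Lemma lint_add (k : C -> C) (c : C) (r : R) (p q s : C) :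
  cont_on k (box c r) -> cauchy_on k (box c r) ->
  box c r p -> box c r q -> box c r s ->
  lint k p q + lint k q s = lint k p s.
Proof.
  destruct p as [p1 p2], q as [q1 q2], s as [s1 s2]. unfold box; simpl.
  rewrite !Rabs_lt_iff. intros Hk Hz Hp Hq Hs.
  assert (HB : forall x y, (fst c - r < x < fst c + r)%R -> (snd c - r < y < snd c + r)%R ->
    box c r (x, y)) by (intros; unfold box; simpl; rewrite !Rabs_lt_iff; lra).
  assert (E : rint k q1 s1 p2 q2 = 0).
  { apply (cauchy_on_unordered k (box c r)); auto.
    intros [x y] Hw. apply HB; minmax. }
  unfold rint in E. unfold lint; simpl.
  assert (E1 : hint k p2 p1 s1 = hint k p2 p1 q1 + hint k p2 q1 s1).
  { apply CInt_Chasles; apply ex_hint; intros; apply Hk, HB; minmax. }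
  assert (E2 : vint k s1 p2 s2 = vint k s1 p2 q2 + vint k s1 q2 s2).
  { apply CInt_Chasles; apply ex_vint; intros; apply Hk, HB; minmax. }
  rewrite E1, E2.
  match goal with |- ?L = ?R => replace L with (R - (hint k p2 q1 s1 - hint k q2 q1 s1 +
     Ci * (vint k s1 p2 q2 - vint k q1 p2 q2))) by ring end.
  rewrite E. ring.
Qed.

Lemma lint_refl (k : C -> C) (p : C) : lint k p p = 0.
Proof. unfold lint, hint, vint. rewrite !CInt_point. ring. Qed.

(** Continuity of [k] suffices: the error is the integral of [k - k w] over two legs, each no longer
    than the distance from [w] to [w']. *)
Lemma lint_near (k : C -> C) (w : C) (r : R) :
  (0 < r)%R -> cont_on k (box w r) ->
  forall eps, (0 < eps)%R -> locally (T := C_UniformSpace) w (fun w' =>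
    (Cmod (lint k w w' - k w * (w' - w)) <= eps * Cmod (w' - w))%R).
Proof.
  intros Hr Hk eps He.
  assert (Hw : contC k w).
  { apply Hk. unfold box. rewrite !Rminus_diag_eq, Rabs_R0 by reflexivity. lra. }
  assert (He2 : (0 < eps / 2)%R) by lra.
  assert (H := Hw _ He2). rewrite locally_Cmod in H. destruct H as (del & Hdel & H).
  (* On the legs both coordinates move by at most the distance, so the modulus of the displacement
     is at most twice it; hence [del / 2]. *)
  apply locally_Cmod. exists (Rmin (del / 2) r). split. apply Rmin_case; lra.
  intros [x' y'] Hw'. destruct w as [x y].
  assert (H1 : (Cmod ((x', y') - (x, y)) < del / 2)%R)
    by (eapply Rlt_le_trans; [exact Hw' | apply Rmin_l]).
  assert (H2 : (Cmod ((x', y') - (x, y)) < r)%R)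
    by (eapply Rlt_le_trans; [exact Hw' | apply Rmin_r]).
  assert (Hx := Cmod_ge_fst ((x', y') - (x, y))). assert (Hy := Cmod_ge_snd ((x', y') - (x, y))).
  set (D := Cmod ((x', y') - (x, y))) in *. simpl in Hx, Hy.
  fold (Rminus x' x) in Hx. fold (Rminus y' y) in Hy.
  assert (Hx3 := Hx). assert (Hy3 := Hy).
  apply Rabs_le_between in Hx3. apply Rabs_le_between in Hy3.
  assert (HB : forall u v, (Rmin x x' <= u <= Rmax x x')%R -> (Rmin y y' <= v <= Rmax y y')%R ->
     contC k (u, v) /\ (Cmod (k (u, v) - k (x, y)) <= eps / 2)%R).
  { intros u v Hu Hv.
    assert (Hux : (Rabs (u - x) <= D)%R) by (apply Rabs_le; minmax).
    assert (Hvy : (Rabs (v - y) <= D)%R) by (apply Rabs_le; minmax).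
    split. apply Hk. split; simpl; lra.
    left. apply H. eapply Rle_lt_trans. apply (Cmod_le_abs (u - x) (v - y)). lra. }
  assert (Hx0 : (Rmin x x' <= x' <= Rmax x x')%R) by minmax.
  assert (Hy0 : (Rmin y y' <= y <= Rmax y y')%R) by minmax.
  assert (E : lint k (x, y) (x', y') - k (x, y) * ((x', y') - (x, y)) =
    hint (fun w => k w - k (x, y)) y x x' + Ci * vint (fun w => k w - k (x, y)) x' y y').
  { rewrite (hint_minus k (fun _ => k (x, y))), (vint_minus k (fun _ => k (x, y)));
      try (intros; (apply contC_const || now apply HB)).
    unfold lint; simpl. unfold hint at 3, vint at 3.
    rewrite (CInt_unique _ _ _ _ (is_CInt_const (k (x, y)) x x')).
    rewrite (CInt_unique _ _ _ _ (is_CInt_const (k (x, y)) y y')).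
    replace (((x', y') : C) - (x, y)) with (RtoC (x' - x) + Ci * RtoC (y' - y)).
    ring. apply injective_projections; simpl; ring. }
  set (g := fun w : C => k w - k (x, y)) in E.
  rewrite E. eapply Rle_trans. apply Cmod_triangle. rewrite Cmod_mult, Cmod_Ci.
  assert (F1 : (Cmod (hint g y x x') <= Rabs (x' - x) * (eps / 2))%R).
  { apply CInt_bound. apply (ex_hint g). intros u Hu.
    apply limC_minus. now apply HB. apply contC_const. intros u Hu. now apply HB. }
  assert (F2 : (Cmod (vint g x' y y') <= Rabs (y' - y) * (eps / 2))%R).
  { apply CInt_bound. apply (ex_vint g). intros u Hu.
    apply limC_minus. now apply HB. apply contC_const. intros u Hu. now apply HB. }
  fold D. nra.
Qed.

(** * Integrals along piecewise C^1 paths *)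

(** As with [cderiv], avoiding quotients spares the chain rule a separate case for parameters with
    [g t = g s]. *)
Definition rderivC (g : R -> C) (s : R) (l : C) : Prop :=
  forall eps : R, (0 < eps)%R -> locally s
    (fun t => (Cmod (g t - g s - RtoC (t - s) * l) <= eps * Rabs (t - s))%R).

Lemma scal_C_R (x : R) (l : C) : scal (V := C_R_NormedModule) x l = RtoC x * l.
Proof. apply injective_projections; simpl; unfold scal; simpl; unfold mult; simpl; ring. Qed.

Lemma is_derive_rderivC (g : R -> C) (s : R) (l : C) :
  is_derive (K := R_AbsRing) (V := C_R_NormedModule) g s l -> rderivC g s l.
Proof.
  intros [_ H] eps He.
  assert (Hs : is_filter_lim (locally s) s) by (intros P HP; exact HP).
  generalize (H s Hs (mkposreal eps He)). apply filter_imp. intros t Ht.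
  rewrite scal_C_R in Ht. rewrite Cmod_norm. exact Ht.
Qed.

Lemma rderivC_limC (g : R -> C) (s : R) (l : C) :
  rderivC g s l -> forall eps : R, (0 < eps)%R -> locally s
    (fun t => (Cmod (g t - g s) <= (Cmod l + eps) * Rabs (t - s))%R).
Proof.
  intros H eps He. generalize (H eps He). apply filter_imp. intros t Ht.
  replace (g t - g s) with (g t - g s - RtoC (t - s) * l + RtoC (t - s) * l) by ring.
  eapply Rle_trans. apply Cmod_triangle. rewrite Cmod_mult, Cmod_R. nra.
Qed.

Lemma rderivC_contR (g : R -> C) (s : R) (l : C) : rderivC g s l -> contR g s.
Proof.
  intros H eps He. assert (H1 := rderivC_limC g s l H 1%R Rlt_0_1).
  rewrite locally_R in H1. destruct H1 as (del & Hdel & H1).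
  assert (Hl := Cmod_ge_0 l).
  apply locally_R. exists (Rmin del (eps / (Cmod l + 1))). split.
  apply Rmin_case. lra. apply Rdiv_lt_0_compat; lra.
  intros t Ht. eapply Rle_lt_trans. apply H1.
  eapply Rlt_le_trans. exact Ht. apply Rmin_l.
  apply Rlt_le_trans with ((Cmod l + 1) * (eps / (Cmod l + 1)))%R.
  apply Rmult_lt_compat_l. lra. eapply Rlt_le_trans. exact Ht. apply Rmin_r.
  right. field. lra.
Qed.

Lemma rderivC_ext (f g : R -> C) (s : R) (l : C) :
  locally s (fun t => f t = g t) -> rderivC f s l -> rderivC g s l.
Proof.
  intros E H eps He. rewrite <- (locally_singleton s _ E).
  generalize (filter_and _ _ E (H eps He)). apply filter_imp. now intros t [<- Ht].
Qed.

Lemma rderivC_minus (f g : R -> C) (s : R) (l m : C) :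
  rderivC f s l -> rderivC g s m -> rderivC (fun t => f t - g t) s (l - m).
Proof.
  intros Hf Hg eps He. assert (He2 : (0 < eps / 2)%R) by lra.
  generalize (filter_and _ _ (Hf _ He2) (Hg _ He2)). apply filter_imp. intros t [H1 H2].
  replace (f t - g t - (f s - g s) - RtoC (t - s) * (l - m))
    with ((f t - f s - RtoC (t - s) * l) - (g t - g s - RtoC (t - s) * m)) by ring.
  eapply Rle_trans. apply Cmod_sub_le. lra.
Qed.

Lemma rderivC_comp (Phi : C -> C) (g : R -> C) (s : R) (l d : C) :
  cderiv Phi (g s) l -> rderivC g s d -> rderivC (fun t => Phi (g t)) s (l * d).
Proof.
  intros HP Hg eps He.
  assert (Hd := Cmod_ge_0 d). assert (Hl := Cmod_ge_0 l).
  (* Near [s] the path [g] moves at most [Cmod d + 1] times as fast as the parameter, so each of the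
     two error terms costs at most [eps / 2]. Adding 1 keeps the denominators nonzero. *)
  set (e1 := (eps / (2 * (Cmod d + 1)))%R). set (e2 := (eps / (2 * (Cmod l + 1)))%R).
  assert (He1 : (0 < e1)%R) by (apply Rdiv_lt_0_compat; lra).
  assert (He2 : (0 < e2)%R) by (apply Rdiv_lt_0_compat; lra).
  assert (E1 : (e1 * (Cmod d + 1) = eps / 2)%R) by (unfold e1; field; lra).
  assert (E2 : (e2 * (Cmod l + 1) = eps / 2)%R) by (unfold e2; field; lra).
  assert (HP1 := HP _ He1). rewrite locally_Cmod in HP1. destruct HP1 as (del & Hdel & HP1).
  generalize (filter_and _ _ (Hg _ He2)
    (filter_and _ _ (rderivC_limC g s d Hg 1%R Rlt_0_1) (rderivC_contR g s d Hg del Hdel))).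
  apply filter_imp. intros t (H1 & H2 & H3). specialize (HP1 _ H3).
  replace (Phi (g t) - Phi (g s) - RtoC (t - s) * (l * d))
    with ((Phi (g t) - Phi (g s) - l * (g t - g s)) + l * (g t - g s - RtoC (t - s) * d)) by ring.
  eapply Rle_trans. apply Cmod_triangle. rewrite Cmod_mult.
  assert (Ht := Rabs_pos (t - s)).
  apply Rle_trans with (e1 * ((Cmod d + 1) * Rabs (t - s)) + Cmod l * (e2 * Rabs (t - s)))%R.
  - apply Rplus_le_compat.
    + eapply Rle_trans. exact HP1. apply Rmult_le_compat_l; lra.
    + now apply Rmult_le_compat_l.
  - apply Rle_trans with ((e1 * (Cmod d + 1)) * Rabs (t - s)
      + (e2 * (Cmod l + 1)) * Rabs (t - s))%R.
    assert (0 <= e2 * Rabs (t - s))%R by (apply Rmult_le_pos; lra). nra.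
    rewrite E1, E2. lra.
Qed.

Lemma real_derive_of_bound (f : R -> R) (s l : R) :
  (forall eps : R, (0 < eps)%R -> locally s
    (fun t => (Rabs (f t - f s - (t - s) * l) <= eps * Rabs (t - s))%R)) ->
  is_derive f s l.
Proof.
  intros H. apply is_derive_Reals. intros eps He.
  assert (He2 : (0 < eps / 2)%R) by lra.
  specialize (H _ He2). rewrite locally_R in H. destruct H as (del & Hdel & H).
  exists (mkposreal del Hdel). intros h Hh Hhd. simpl in Hhd.
  specialize (H (s + h)%R). replace (s + h - s)%R with h in H by ring.
  specialize (H Hhd).
  replace ((f (s + h) - f s) / h - l)%R with ((f (s + h) - f s - h * l) / h)%R by now field.
  assert (Hp := Rabs_pos_lt h Hh).
  unfold Rdiv. rewrite Rabs_mult, Rabs_inv.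
  apply (Rmult_lt_reg_r (Rabs h)). exact Hp.
  rewrite Rmult_assoc, Rinv_l by lra. nra.
Qed.

Lemma rderivC_fst (g : R -> C) (s : R) (l : C) :
  rderivC g s l -> is_derive (fun t => fst (g t)) s (fst l).
Proof.
  intros H. apply real_derive_of_bound. intros eps He. generalize (H eps He).
  apply filter_imp. intros t Ht. eapply Rle_trans. 2: exact Ht.
  eapply Rle_trans. 2: apply Cmod_ge_fst. right. f_equal. simpl. ring.
Qed.

Lemma rderivC_snd (g : R -> C) (s : R) (l : C) :
  rderivC g s l -> is_derive (fun t => snd (g t)) s (snd l).
Proof.
  intros H. apply real_derive_of_bound. intros eps He. generalize (H eps He).
  apply filter_imp. intros t Ht. eapply Rle_trans. 2: exact Ht.
  eapply Rle_trans. 2: apply Cmod_ge_snd. right. f_equal. simpl. ring.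
Qed.

Lemma path_derive_eq (g : R -> C) (s : R) (l : C) : rderivC g s l -> path_derive g s = l.
Proof.
  intros H. apply injective_projections; simpl; apply is_derive_unique.
  now apply rderivC_fst. now apply rderivC_snd.
Qed.

Lemma contR_real (h : C -> R) (g : R -> C) (s : R) :
  (forall z w, (Rabs (h z - h w) <= Cmod (z - w))%R) ->
  contR g s -> continuity_pt (fun t => h (g t)) s.
Proof.
  intros Hh Hg. apply continuity_pt_filterlim. apply filterlim_locally. intros eps.
  generalize (Hg eps (cond_pos eps)). apply filter_imp. intros t Ht.
  eapply Rle_lt_trans. apply Hh. exact Ht.
Qed.

(** The mean value theorem fails for complex values, so it is applied to the two components. *)
Lemma constant_of_zero_derivative (g : R -> C) (a b : R) :
  (a < b)%R -> (forall t, contR g t) -> (forall s, (a < s < b)%R -> rderivC g s 0) -> g b = g a.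
Proof.
  intros Hab Hc Hd. apply injective_projections.
  - destruct (MVT_gen (fun t => fst (g t)) a b (fun _ => 0%R)) as (c & _ & E);
      rewrite ?Rmin_left, ?Rmax_right by lra.
    + intros s Hs. now apply (rderivC_fst g s 0), Hd.
    + intros s Hs. apply (contR_real fst); auto. intros z w.
      eapply Rle_trans. 2: apply Cmod_ge_fst. right. f_equal.
    + lra.
  - destruct (MVT_gen (fun t => snd (g t)) a b (fun _ => 0%R)) as (c & _ & E);
      rewrite ?Rmin_left, ?Rmax_right by lra.
    + intros s Hs. now apply (rderivC_snd g s 0), Hd.
    + intros s Hs. apply (contR_real snd); auto. intros z w.
      eapply Rle_trans. 2: apply Cmod_ge_snd. right. f_equal.
    + lra.
Qed.

(** The difference of [Phi] along the path and the indefinite integral is continuous with zero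
    derivative inside, hence constant. Continuity on the whole line is asked of [g] and [d] so that
    no one-sided limits arise; [C1_on_extend] provides it. *)
Lemma ftc_piece (Phi k : C -> C) (g d : R -> C) (a b : R) :
  (a < b)%R -> (forall t, contR g t) -> (forall t, contR d t) ->
  (forall s, (a < s < b)%R -> rderivC g s (d s)) ->
  (forall t, cderiv Phi (g t) (k (g t))) -> (forall t, contC k (g t)) ->
  is_CInt (fun t => k (g t) * d t) a b (Phi (g b) - Phi (g a)).
Proof.
  intros Hab Hg Hd Hgd HPhi Hk.
  set (F := fun t => k (g t) * d t).
  assert (HF : forall t, contR F t).
  { intros t. apply limC_mult. apply limC_comp; auto. apply locally_filter. apply Hg. apply Hd. }
  assert (Hex : forall u v, ex_CInt F u v) by (intros; apply ex_CInt_cont; auto).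
  set (G := fun u => Phi (g u) - CInt F a u).
  assert (HI : forall s, rderivC (fun u => CInt F a u) s (F s)).
  { intros s. apply is_derive_rderivC.
    apply (is_derive_RInt (V := C_R_NormedModule) F (fun u => CInt F a u) a s).
    - apply filter_forall. intros u. now apply CInt_correct.
    - apply contR_continuous, HF. }
  assert (E : G b = G a).
  { apply constant_of_zero_derivative. exact Hab.
    - intros t. apply limC_minus.
      + apply limC_comp. apply locally_filter. apply Hg. eapply cderiv_contC, HPhi.
      + exact (rderivC_contR _ _ _ (HI t)).
    - intros s Hs. replace (RtoC 0) with (k (g s) * d s - F s) by (unfold F; ring).
      apply (rderivC_minus (fun u => Phi (g u)) (fun u => CInt F a u)); [|apply HI].
      apply rderivC_comp. apply HPhi. now apply Hgd. }
  unfold G in E. rewrite CInt_point in E.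
  assert (A : forall p q i : C, p - i = q - 0 -> p - q = i).
  { intros p q i Hi. replace p with (p - i + i) by ring. rewrite Hi. ring. }
  rewrite (A _ _ _ E). now apply CInt_correct.
Qed.

(** Precomposing with this retraction onto [[a, b]] extends a function constantly beyond both ends,
    which turns one-sided continuity there into ordinary continuity. *)
Definition clamp (a b t : R) : R := Rmax a (Rmin b t).

Lemma contR_clamp (g : R -> C) (a b : R) :
  (a <= b)%R -> continuous_path a b g -> forall t, contR (fun s => g (clamp a b s)) t.
Proof.
  intros Hab Hg t eps He.
  assert (Hx : (a <= clamp a b t <= b)%R) by (unfold clamp; minmax).
  assert (H := proj2 (limC_filterlim _ g _) (Hg _ Hx) eps He).
  unfold within in H. rewrite locally_R in H. destruct H as (del & Hdel & H).
  apply locally_R. exists del. split. exact Hdel. intros s Hs. apply H.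
  - eapply Rle_lt_trans. 2: exact Hs. unfold clamp. unfold Rabs.
    destruct Rcase_abs, Rcase_abs; minmax.
  - unfold clamp; minmax.
Qed.

Definition C1_on (g : R -> C) (a b : R) : Prop :=
  continuous_path a b g /\
  exists d : R -> C, continuous_path a b d /\
    forall s : R, (a < s < b)%R ->
      is_derive (K := R_AbsRing) (V := C_R_NormedModule) g s (d s).

(** Since the extension takes only values of [gamma] on [[a, b]], facts known along the path
    transfer to it. Agreement of derivatives inside the interval is enough for integrals. *)
Lemma C1_on_extend (gamma : R -> C) (a b : R) :
  (a < b)%R -> C1_on gamma a b -> exists g d : R -> C,
    (forall t, contR g t) /\ (forall t, contR d t) /\
    (forall t, exists s, (a <= s <= b)%R /\ g t = gamma s) /\
    g a = gamma a /\ g b = gamma b /\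
    (forall s, (a < s < b)%R ->
       g s = gamma s /\ path_derive gamma s = d s /\ rderivC g s (d s)).
Proof.
  intros Hab [Hg (d & Hd & Hgd)].
  exists (fun t => gamma (clamp a b t)), (fun t => d (clamp a b t)).
  assert (Hin : forall s, (a <= s <= b)%R -> clamp a b s = s) by (intros; unfold clamp; minmax).
  repeat split.
  - apply contR_clamp; auto. lra.
  - apply contR_clamp; auto. lra.
  - intros t. exists (clamp a b t). split; [unfold clamp; minmax | reflexivity].
  - rewrite Hin; [reflexivity | lra].
  - rewrite Hin; [reflexivity | lra].
  - rewrite Hin; [reflexivity | lra].
  - rewrite Hin by lra. now apply path_derive_eq, is_derive_rderivC, Hgd.
  - rewrite Hin by lra. apply rderivC_ext with gamma.
    + apply locally_R. exists (Rmin (s - a) (b - s)). split. apply Rmin_case; lra.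
      intros t Ht. rewrite Hin. reflexivity.
      apply Rabs_lt_iff in Ht. minmax.
    + now apply is_derive_rderivC, Hgd.
Qed.

(** Properties that are additive over adjacent intervals reduce to a single smooth piece, so the
    break points appear nowhere else. *)
Lemma piecewise_C1_ind (gamma : R -> C) (P : R -> R -> Prop) :
  piecewise_C1 gamma ->
  (forall a b c, P a b -> P b c -> P a c) ->
  (forall a b, (0 <= a)%R -> (a < b)%R -> (b <= 1)%R -> C1_on gamma a b -> P a b) ->
  P 0%R 1%R.
Proof.
  intros [Hc (n & t & H0 & Hn & Ht)] Htrans Hpiece.
  assert (Hmono : forall i j, (i <= j)%nat -> (j <= n)%nat -> (t i <= t j)%R).
  { intros i j Hij. induction Hij. lra. intros Hj.
    destruct (Ht m) as [Hlt _]. lia. specialize (IHHij ltac:(lia)). lra. }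
  assert (Hpc : forall i, (i < n)%nat -> P (t i) (t (S i))).
  { intros i Hi. destruct (Ht i Hi) as [Hlt Hd].
    assert (H1 : (0 <= t i)%R) by (rewrite <- H0; apply Hmono; lia).
    assert (H2 : (t (S i) <= 1)%R) by (rewrite <- Hn; apply Hmono; lia).
    apply Hpiece; auto. split; [|exact Hd].
    intros s Hs. assert (Hs1 : (0 <= s <= 1)%R) by lra.
    generalize (Hc s Hs1). apply filterlim_filter_le_1.
    intros Q. unfold within. apply filter_imp. intros u Hu Hu'. apply Hu. lra. }
  assert (HP : forall i, (i < n)%nat -> P (t O) (t (S i))).
  { induction i as [|i IH]; intros Hi. now apply Hpc.
    apply Htrans with (t (S i)). apply IH. lia. now apply Hpc. }
  (* With no pieces, 0 and 1 would coincide. *)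
  destruct n as [|n]. lra.
  rewrite <- H0, <- Hn. apply HP. lia.
Qed.

Definition integrand (F : C -> C) (gamma : R -> C) (t : R) : C := F (gamma t) * path_derive gamma t.

(** The primitive is needed only at the points of the path. The function [prim] below is known to
    have derivative [k] just at points of [K]. *)
Lemma contour_ftc (gamma : R -> C) (Phi k : C -> C) :
  piecewise_C1 gamma ->
  (forall t, (0 <= t <= 1)%R -> cderiv Phi (gamma t) (k (gamma t))) ->
  (forall t, (0 <= t <= 1)%R -> contC k (gamma t)) ->
  contour_integral k gamma = Phi (gamma 1%R) - Phi (gamma 0%R).
Proof.
  intros Hg HPhi Hk. apply CInt_unique.
  apply (piecewise_C1_ind gamma (fun a b =>
    is_CInt (integrand k gamma) a b (Phi (gamma b) - Phi (gamma a))) Hg).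
  - intros a b c H1 H2.
    replace (Phi (gamma c) - Phi (gamma a))
      with ((Phi (gamma b) - Phi (gamma a)) + (Phi (gamma c) - Phi (gamma b))) by ring.
    now apply is_CInt_Chasles with b.
  - intros a b Ha Hab Hb HC.
    destruct (C1_on_extend gamma a b Hab HC) as (g & d & Hgc & Hdc & Him & Ea & Eb & Hin).
    rewrite <- Ea, <- Eb.
    apply is_CInt_ext with (fun t => k (g t) * d t).
    + intros s. rewrite Rmin_left, Rmax_right by lra. intros Hs.
      destruct (Hin s Hs) as (E1 & E2 & _). unfold integrand. now rewrite E1, E2.
    + apply ftc_piece; auto.
      * intros s Hs. now apply Hin.
      * intros t. destruct (Him t) as (s & Hs & ->). apply HPhi. lra.
      * intros t. destruct (Him t) as (s & Hs & ->). apply Hk. lra.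
Qed.

Lemma contour_ex (gamma : R -> C) (k : C -> C) :
  piecewise_C1 gamma -> (forall t, (0 <= t <= 1)%R -> contC k (gamma t)) ->
  ex_CInt (integrand k gamma) 0 1.
Proof.
  intros Hg Hk.
  apply (piecewise_C1_ind gamma (fun a b => ex_CInt (integrand k gamma) a b) Hg).
  - intros a b c [l Hl] [m Hm]. exists (l + m). now apply is_CInt_Chasles with b.
  - intros a b Ha Hab Hb HC.
    destruct (C1_on_extend gamma a b Hab HC) as (g & d & Hgc & Hdc & Him & Ea & Eb & Hin).
    assert (Hex : ex_CInt (fun t => k (g t) * d t) a b).
    { apply ex_CInt_cont. intros t _. apply limC_mult; [|apply Hdc].
      apply limC_comp. apply locally_filter. apply Hgc.
      destruct (Him t) as (s & Hs & ->). apply Hk. lra. }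
    destruct Hex as [l Hl]. exists l. revert Hl. apply is_CInt_ext.
    intros s. rewrite Rmin_left, Rmax_right by lra. intros Hs.
    destruct (Hin s Hs) as (E1 & E2 & _). unfold integrand. now rewrite E1, E2.
Qed.

Lemma contR_bounded (d : R -> C) (a b : R) :
  (a <= b)%R -> (forall t, (a <= t <= b)%R -> contR d t) -> exists D, (0 <= D)%R /\ forall t, (a <= t <= b)%R -> (Cmod (d t) <= D)%R.
Proof.
  intros Hab Hd.
  destruct (continuity_ab_maj (fun t => Cmod (d t)) a b Hab) as (m & Hm & _).
  - intros t Ht. apply (contR_real Cmod d t); auto. intros z w.
    apply Rabs_le. generalize (Cmod_sub_ge z w) (Cmod_sub_ge w z). rewrite (Cmod_sub_sym w z). lra.
  - exists (Cmod (d m)). split. apply Cmod_ge_0. exact Hm.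
Qed.

(** [L] replaces the length of the path: the sum over the pieces of duration times a bound for the
    speed. What matters is that it does not depend on the integrand. *)
Lemma contour_bound (gamma : R -> C) :
  piecewise_C1 gamma -> exists L, (0 <= L)%R /\
    forall (k : C -> C) (M : R), (forall t, (0 <= t <= 1)%R -> contC k (gamma t)) ->
      (0 <= M)%R -> (forall t, (0 <= t <= 1)%R -> (Cmod (k (gamma t)) <= M)%R) ->
      (Cmod (contour_integral k gamma) <= L * M)%R.
Proof.
  intros Hg.
  (* Integrability is added to the claim because joining two intervals in the induction requires
     it. *)
  cut (exists L, (0 <= L)%R /\
    forall (k : C -> C) (M : R), (forall t, (0 <= t <= 1)%R -> contC k (gamma t)) ->
      (0 <= M)%R -> (forall t, (0 <= t <= 1)%R -> (Cmod (k (gamma t)) <= M)%R) ->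
      ex_CInt (integrand k gamma) 0%R 1%R /\
      (Cmod (CInt (integrand k gamma) 0%R 1%R) <= L * M)%R).
  { intros (L & HL & H). exists L. split. exact HL. intros k M H1 H2 H3.
    now apply (H k M). }
  apply (piecewise_C1_ind gamma (fun a b => exists L, (0 <= L)%R /\
    forall (k : C -> C) (M : R), (forall t, (0 <= t <= 1)%R -> contC k (gamma t)) ->
      (0 <= M)%R -> (forall t, (0 <= t <= 1)%R -> (Cmod (k (gamma t)) <= M)%R) ->
      ex_CInt (integrand k gamma) a b /\ (Cmod (CInt (integrand k gamma) a b) <= L * M)%R) Hg).
  - intros a b c (L1 & HL1 & H1) (L2 & HL2 & H2). exists (L1 + L2)%R. split. lra.
    intros k M Hk HM Hb.
    destruct (H1 k M Hk HM Hb) as [[l1 X1] B1]. destruct (H2 k M Hk HM Hb) as [[l2 X2] B2].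
    split. exists (l1 + l2). now apply is_CInt_Chasles with b.
    rewrite (CInt_Chasles _ a b c); [| now exists l1 | now exists l2].
    eapply Rle_trans. apply Cmod_triangle. lra.
  - intros a b Ha Hab Hb HC.
    destruct (C1_on_extend gamma a b Hab HC) as (g & d & Hgc & Hdc & Him & Ea & Eb & Hin).
    destruct (contR_bounded d a b ltac:(lra) ltac:(auto)) as (D & HD & HdD).
    exists ((b - a) * D)%R. split. apply Rmult_le_pos; lra.
    intros k M Hk HM HkM.
    assert (Hex : ex_CInt (fun t => k (g t) * d t) a b).
    { apply ex_CInt_cont. intros t _. apply limC_mult; [|apply Hdc].
      apply limC_comp. apply locally_filter. apply Hgc.
      destruct (Him t) as (s & Hs & ->). apply Hk. lra. }
    assert (Heq : forall s, (Rmin a b < s < Rmax a b)%R ->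
      k (g s) * d s = integrand k gamma s).
    { intros s. rewrite Rmin_left, Rmax_right by lra. intros Hs.
      destruct (Hin s Hs) as (E1 & E2 & _). unfold integrand. now rewrite E1, E2. }
    split.
    + destruct Hex as [l Hl]. exists l. revert Hl. now apply is_CInt_ext.
    + rewrite <- (CInt_ext _ _ _ _ Heq).
      rewrite Rmult_assoc, <- (Rabs_pos_eq (b - a)) by lra.
      apply CInt_bound. exact Hex.
      rewrite Rmin_left, Rmax_right by lra. intros t Ht. rewrite Cmod_mult, (Rmult_comm D).
      destruct (Him t) as (s & Hs & ->).
      apply Rmult_le_compat; try apply Cmod_ge_0. apply HkM; lra. now apply HdD.
Qed.

Lemma contour_minus (gamma : R -> C) (k1 k2 : C -> C) :
  piecewise_C1 gamma -> (forall t, (0 <= t <= 1)%R -> contC k1 (gamma t)) ->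
  (forall t, (0 <= t <= 1)%R -> contC k2 (gamma t)) ->
  contour_integral (fun w => k1 w - k2 w) gamma
  = contour_integral k1 gamma - contour_integral k2 gamma.
Proof.
  intros Hg H1 H2. unfold contour_integral.
  rewrite <- (CInt_minus (integrand k1 gamma) (integrand k2 gamma)) by now apply contour_ex.
  apply CInt_ext. intros t _. unfold integrand. ring.
Qed.

Lemma contour_plus (gamma : R -> C) (k1 k2 : C -> C) :
  piecewise_C1 gamma -> (forall t, (0 <= t <= 1)%R -> contC k1 (gamma t)) ->
  (forall t, (0 <= t <= 1)%R -> contC k2 (gamma t)) ->
  contour_integral (fun w => k1 w + k2 w) gamma
  = contour_integral k1 gamma + contour_integral k2 gamma.
Proof.
  intros Hg H1 H2. unfold contour_integral.
  rewrite <- (CInt_plus (integrand k1 gamma) (integrand k2 gamma)) by now apply contour_ex.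
  apply CInt_ext. intros t _. unfold integrand. ring.
Qed.

Lemma contour_scal (gamma : R -> C) (z : C) (k : C -> C) :
  piecewise_C1 gamma -> (forall t, (0 <= t <= 1)%R -> contC k (gamma t)) ->
  contour_integral (fun w => z * k w) gamma = z * contour_integral k gamma.
Proof.
  intros Hg H. unfold contour_integral.
  rewrite <- (CInt_scal z (integrand k gamma)) by now apply contour_ex.
  apply CInt_ext. intros t _. unfold integrand. ring.
Qed.

Lemma contour_ext (gamma : R -> C) (k1 k2 : C -> C) :
  (forall t, (0 <= t <= 1)%R -> k1 (gamma t) = k2 (gamma t)) ->
  contour_integral k1 gamma = contour_integral k2 gamma.
Proof.
  intros H. apply CInt_ext. intros t. rewrite Rmin_left, Rmax_right by lra. intros Ht.
  rewrite H by lra. reflexivity.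
Qed.

(** * Cauchy's theorem for null-homologous paths *)

Lemma cderiv_inv_sub (c w : C) : w <> c -> exists l, cderiv (fun u => / (u - c)) w l.
Proof.
  intros H. eexists. apply (cderiv_inv (fun u => u - c)). now apply Cneq_sub.
  apply (cderiv_plus (fun u => u) (fun _ => - c)). apply cderiv_id. apply cderiv_const.
Qed.

Lemma contC_inv_sub (c w : C) : w <> c -> contC (fun u => / (u - c)) w.
Proof. intros H. destruct (cderiv_inv_sub c w H) as [l Hl]. exact (cderiv_contC _ _ _ Hl). Qed.

Lemma Im_CInt_pos (f : R -> C) (a b : R) :
  (a < b)%R -> (forall t, (a <= t <= b)%R -> contR f t) ->
  (forall t, (a < t < b)%R -> (0 < snd (f t))%R) -> (0 < snd (CInt f a b : C))%R.
Proof.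
  intros Hab Hc Hp.
  assert (Hex : ex_CInt f a b).
  { apply ex_CInt_cont. rewrite Rmin_left, Rmax_right by lra. exact Hc. }
  assert (H := is_RInt_fct_extend_snd (U := R_NormedModule) (V := R_NormedModule) f a b _
                 (CInt_correct _ _ _ Hex)).
  apply (is_RInt_unique (V := R_CompleteNormedModule)) in H.
  refine (eq_ind _ (fun r => (0 < r)%R) _ _ H).
  apply RInt_gt_0; auto. intros t Ht.
  apply continuity_pt_filterlim. apply (contR_real snd f t); auto. intros z w.
  eapply Rle_trans. 2: apply Cmod_ge_snd. right. f_equal.
Qed.

(** Only nonvanishing is needed, not the value of the integral. Each pair of opposite sides
    contributes an integrand with imaginary part 2h / (s^2 + h^2), where s is the offset from the
    centre along the side, so the imaginary part of the total is positive. *)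
Lemma rint_inv_center (c : C) (h : R) :
  (0 < h)%R ->
  rint (fun w => / (w - c)) (fst c - h) (fst c + h) (snd c - h) (snd c + h) <> 0.
Proof.
  intros Hh. destruct c as [c1 c2]. simpl. set (g := fun w : C => / (w - (c1, c2))).
  assert (Hgc : forall x y, (x <> c1 \/ y <> c2)%R -> contC g (x, y)).
  { intros x y H. apply contC_inv_sub. intros E. injection E. intros; subst.
    destruct H; auto. }
  unfold rint, hint, vint.
  assert (Hy1 : forall x, contR (fun t => g (t, (c2 - h)%R)) x)
    by (intros x; apply contR_hline, Hgc; right; lra).
  assert (Hy2 : forall x, contR (fun t => g (t, (c2 + h)%R)) x)
    by (intros x; apply contR_hline, Hgc; right; lra).
  assert (Hx1 : forall y, contR (fun t => g ((c1 - h)%R, t)) y)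
    by (intros y; apply contR_vline, Hgc; left; lra).
  assert (Hx2 : forall y, contR (fun t => g ((c1 + h)%R, t)) y)
    by (intros y; apply contR_vline, Hgc; left; lra).
  rewrite <- CInt_minus by (apply ex_CInt_cont; auto).
  rewrite <- CInt_minus by (apply ex_CInt_cont; auto).
  rewrite <- CInt_scal.
  2:{ apply ex_CInt_cont. intros t _. now apply contR_minus. }
  match goal with |- ?a + ?b <> _ =>
    assert (Ha : (0 < snd (a : C))%R); [|assert (Hb : (0 < snd (b : C))%R)] end.
  - apply Im_CInt_pos. lra. intros t _. now apply contR_minus. intros t _.
    replace (snd (g (t, (c2 - h)%R) - g (t, (c2 + h)%R)))
      with (2 * h / ((t - c1) ^ 2 + h ^ 2))%R.
    apply Rdiv_lt_0_compat; [lra | apply Rplus_le_lt_0_compat; [apply pow2_ge_0 | apply pow_lt; lra]].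
    unfold g, Cinv; simpl. field. apply Rgt_not_eq.
    generalize (Rmult_lt_0_compat h h Hh Hh) (pow2_ge_0 (t - c1)). lra.
  - apply Im_CInt_pos. lra.
    intros t _. apply (contR_mult (fun _ => Ci)). apply limC_const. now apply contR_minus.
    intros t _.
    replace (snd (Ci * (g ((c1 + h)%R, t) - g ((c1 - h)%R, t))))
      with (2 * h / ((t - c2) ^ 2 + h ^ 2))%R.
    apply Rdiv_lt_0_compat; [lra | apply Rplus_le_lt_0_compat; [apply pow2_ge_0 | apply pow_lt; lra]].
    unfold g, Cinv; simpl. field. apply Rgt_not_eq.
    generalize (Rmult_lt_0_compat h h Hh Hh) (pow2_ge_0 (t - c2)). lra.
  - intros E. apply (f_equal (snd : C -> R)) in E. change (snd (RtoC 0)) with 0%R in E.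
    assert (Hs : forall x y : C, (0 < snd x)%R -> (0 < snd y)%R -> snd (x + y) <> 0%R)
      by (intros x y; simpl; lra).
    exact (Hs _ _ Ha Hb E).
Qed.

(** * Discrete potentials on a square grid *)

Fixpoint psum (u : nat -> C) (n : nat) : C :=
  match n with O => 0 | S n => psum u n + u n end.

(** For [r >= 0] this is the floor: [up r] exceeds [r] by a positive amount that is at most 1. *)
Definition idx (r : R) : nat := Z.to_nat (up r - 1).

Lemma idx_spec (r : R) : (0 <= r)%R -> (INR (idx r) <= r < INR (idx r) + 1)%R.
Proof.
  intros Hr. destruct (archimed r) as [H1 H2].
  assert (Hz : (0 < up r)%Z) by (apply lt_IZR; lra).
  unfold idx. rewrite INR_IZR_INZ, Z2Nat.id by lia. rewrite minus_IZR. lra.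
Qed.

Section Grid.

Context (gamma : R -> C) (Hgamma : piecewise_C1 gamma) (Hclosed : gamma 0%R = gamma 1%R).
Context (K : C -> Prop) (HKgamma : forall t, (0 <= t <= 1)%R -> K (gamma t)).
Context (X Y del : R) (Hdel : (0 < del)%R) (N : nat).
(** A margin of one cell is kept around [K], so that points within [del] of [K] still have cell
    indices in range. *)
Context (HK : forall w, K w ->
  (X + del <= fst w <= X + (INR N - 1) * del)%R /\ (Y + del <= snd w <= Y + (INR N - 1) * del)%R).

Definition gx (m : nat) : R := (X + INR m * del)%R.
Definition gy (n : nat) : R := (Y + INR n * del)%R.
Definition node (m n : nat) : C := (gx m, gy n).
Definition cell (m n : nat) : C -> Prop := rect (gx m) (gx (S m)) (gy n) (gy (S n)).
Definition center (m n : nat) : C := ((gx m + del / 2)%R, (gy n + del / 2)%R).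
(** A point within [del] of [p] lies in a cell whose lower left node is within [2 * del] of [p]; the
    radius [3 * del] contains such nodes and the edges joining them. *)
Definition nbhd (w : C) : Prop := exists p, K p /\ box p (3 * del) w.

Definition hedge (k : C -> C) (m n : nat) : C := hint k (gy n) (gx m) (gx (S m)).
Definition vedge (k : C -> C) (m n : nat) : C := Ci * vint k (gx m) (gy n) (gy (S n)).

(** Away from [K] the data [H], [V] are free: there [k] need not be integrable, and the corrections
    that kill circulations must still be linear. *)
Definition agrees (k : C -> C) (H V : nat -> nat -> C) : Prop :=
  (forall m n, (forall x, (gx m <= x <= gx (S m))%R -> nbhd (x, gy n)) -> H m n = hedge k m n) /\
  (forall m n, (forall y, (gy n <= y <= gy (S n))%R -> nbhd (gx m, y)) -> V m n = vedge k m n).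

Definition circ (H V : nat -> nat -> C) (m n : nat) : C :=
  H m n - H m (S n) + (V (S m) n - V m n).

Lemma gx_S m : gx (S m) = (gx m + del)%R.
Proof. unfold gx. rewrite S_INR. ring. Qed.

Lemma gy_S n : gy (S n) = (gy n + del)%R.
Proof. unfold gy. rewrite S_INR. ring. Qed.

Lemma circ_edges (k : C -> C) (m n : nat) :
  circ (hedge k) (vedge k) m n = rint k (gx m) (gx (S m)) (gy n) (gy (S n)).
Proof. unfold circ, hedge, vedge, rint. ring. Qed.

Definition xidx (w : C) : nat := idx ((fst w - X) / del).
Definition yidx (w : C) : nat := idx ((snd w - Y) / del).

Lemma near_K (w w' : C) :
  K w -> box w del w' ->
  (gx (xidx w') <= fst w' < gx (xidx w') + del)%R /\
  (gy (yidx w') <= snd w' < gy (yidx w') + del)%R /\ (xidx w' < N)%nat /\ (yidx w' < N)%nat.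
Proof.
  intros Hw [Hx Hy]. destruct (HK w Hw) as [H1 H2].
  apply Rabs_lt_iff in Hx. apply Rabs_lt_iff in Hy.
  assert (A : forall z Z : R, (Z <= z < Z + INR N * del)%R ->
    let m := idx ((z - Z) / del) in
    (Z + INR m * del <= z < Z + INR m * del + del)%R /\ (m < N)%nat).
  { intros z Z Hz m.
    assert (E : ((z - Z) / del * del = z - Z)%R) by (field; lra).
    assert (H0 : (0 <= (z - Z) / del)%R) by (apply Rmult_le_pos; [lra | left; now apply Rinv_0_lt_compat]).
    assert (Hm := idx_spec _ H0). fold m in Hm. split. nra.
    apply INR_lt. apply (Rmult_lt_reg_r del). exact Hdel. nra. }
  destruct (A (fst w') X) as [? ?]. lra.
  destruct (A (snd w') Y) as [? ?]. lra.
  auto.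
Qed.

Lemma box_refl (w : C) (r : R) : (0 < r)%R -> box w r w.
Proof. intros Hr. unfold box. rewrite !Rminus_diag_eq, Rabs_R0 by reflexivity. auto. Qed.

Section Potential.

Context (k : C -> C) (Hk : cont_on k nbhd) (Hz : cauchy_on k nbhd).
Context (H V : nat -> nat -> C) (HHV : agrees k H V).
Context (Hcirc : forall m n, (m < N)%nat -> (n < N)%nat -> circ H V m n = 0).

(** The data are summed along the bottom row and then up a column. Vertical differences are right by
    construction; horizontal ones rest on the vanishing circulations. *)
Definition pot (m n : nat) : C := psum (fun i => H i O) m + psum (fun j => V m j) n.

Lemma pot_V (m n : nat) : pot m (S n) - pot m n = V m n.
Proof. unfold pot. simpl. ring. Qed.

(** Climbing one row replaces the bottom edge of a cell by its top edge, and the change is the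
    circulation around that cell. *)
Lemma pot_H (m n : nat) : (m < N)%nat -> (n <= N)%nat -> pot (S m) n - pot m n = H m n.
Proof.
  intros Hm. induction n as [|n IH]; intros Hn.
  - unfold pot. simpl. ring.
  - assert (E := Hcirc m n Hm ltac:(lia)). specialize (IH ltac:(lia)).
    assert (E1 := pot_V m n). assert (E2 := pot_V (S m) n).
    replace (pot (S m) (S n)) with (pot (S m) n + V (S m) n) by (rewrite <- E2; ring).
    replace (pot m (S n)) with (pot m n + V m n) by (rewrite <- E1; ring).
    replace (H m (S n)) with (H m (S n) + circ H V m n) by (rewrite E; ring).
    unfold circ. rewrite <- IH. ring.
Qed.

Context (w : C) (Hw : K w).

Lemma box_nbhd (u : C) : box w (3 * del) u -> nbhd u.
Proof. intros Hu. now exists w. Qed.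

Lemma lint_add_near (p q s : C) :
  box w (3 * del) p -> box w (3 * del) q -> box w (3 * del) s ->
  lint k p q + lint k q s = lint k p s.
Proof.
  apply lint_add.
  - intros u Hu. now apply Hk, box_nbhd.
  - intros a b c d Hab Hcd HS. apply Hz; auto. intros u Hu. now apply box_nbhd, HS.
Qed.

Lemma lint_sym_near (p q : C) :
  box w (3 * del) p -> box w (3 * del) q -> lint k q p = - lint k p q.
Proof.
  intros Hp Hq. assert (E := lint_add_near p q p Hp Hq Hp). rewrite lint_refl in E.
  replace (lint k q p) with (lint k p q + lint k q p - lint k p q) by ring.
  rewrite E. ring.
Qed.

Lemma lint_hstep (m n : nat) :
  (m < N)%nat -> (n <= N)%nat -> box w (3 * del) (node m n) -> box w (3 * del) (node (S m) n) ->
  lint k (node m n) (node (S m) n) = pot (S m) n - pot m n.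
Proof.
  intros Hm Hn B1 B2. rewrite pot_H by assumption.
  rewrite (proj1 HHV). unfold lint, hedge, node, vint; simpl fst; simpl snd.
  rewrite CInt_point. ring.
  intros x Hx. apply box_nbhd. unfold box, node in *. simpl in *.
  rewrite Rabs_lt_iff in *. lra.
Qed.

Lemma lint_vstep (m n : nat) :
  box w (3 * del) (node m n) -> box w (3 * del) (node m (S n)) ->
  lint k (node m n) (node m (S n)) = pot m (S n) - pot m n.
Proof.
  intros B1 B2. rewrite pot_V.
  rewrite (proj2 HHV). unfold lint, vedge, node, hint; simpl fst; simpl snd.
  rewrite CInt_point. ring.
  intros x Hx. apply box_nbhd. unfold box, node in *. simpl in *.
  rewrite !Rabs_lt_iff in *. lra.
Qed.

(** Nearby points lie in equal or adjacent cells, diagonally adjacent ones included, so at most one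
    horizontal and one vertical step join their nodes. The intermediate node shares one coordinate
    with each end and so stays in the box. *)
Lemma lint_nodes (m n m' n' : nat) :
  (m < N)%nat -> (n < N)%nat -> (m' < N)%nat -> (n' < N)%nat ->
  (m <= S m')%nat -> (m' <= S m)%nat -> (n <= S n')%nat -> (n' <= S n)%nat ->
  box w (3 * del) (node m n) -> box w (3 * del) (node m' n') ->
  lint k (node m n) (node m' n') = pot m' n' - pot m n.
Proof.
  intros Hm Hn Hm' Hn' H1 H2 H3 H4 B1 B2.
  assert (B3 : box w (3 * del) (node m' n)) by (unfold box, node in *; simpl in *; tauto).
  rewrite <- (lint_add_near _ (node m' n)) by assumption.
  assert (E1 : lint k (node m n) (node m' n) = pot m' n - pot m n).
  { assert (C : m' = m \/ m' = S m \/ m = S m') by lia. destruct C as [-> | [-> | ->]].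
    - rewrite lint_refl. ring.
    - apply lint_hstep; auto; lia.
    - rewrite (lint_sym_near (node m' n)) by assumption.
      rewrite lint_hstep by (assumption || lia). ring. }
  assert (E2 : lint k (node m' n) (node m' n') = pot m' n' - pot m' n).
  { assert (C : n' = n \/ n' = S n \/ n = S n') by lia. destruct C as [-> | [-> | ->]].
    - rewrite lint_refl. ring.
    - now apply lint_vstep.
    - rewrite (lint_sym_near (node m' n')) by assumption.
      rewrite lint_vstep by assumption. ring. }
  rewrite E1, E2. ring.
Qed.

(** Each point is reached from the lower left node of its own cell. Nothing is claimed across cell
    borders far from [K]; near [K] the next lemma shows that the values fit together. *)
Definition prim (u : C) : C :=
  pot (xidx u) (yidx u) + lint k (node (xidx u) (yidx u)) u.

(** All four points, [w], [u] and their nodes, lie in one box where [lint] is additive, and there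
    [pot] agrees with [lint] between the nodes. *)
Lemma prim_diff (u : C) : box w del u -> prim u - prim w = lint k w u.
Proof.
  intros Hu.
  destruct (near_K w w Hw (box_refl w del Hdel)) as (A1 & A2 & A3 & A4).
  destruct (near_K w u Hw Hu) as (U1 & U2 & U3 & U4).
  destruct Hu as [Hu1 Hu2]. rewrite Rabs_lt_iff in Hu1, Hu2.
  assert (B1 : box w (3 * del) (node (xidx w) (yidx w)))
    by (unfold box, node; simpl; rewrite !Rabs_lt_iff; lra).
  assert (B2 : box w (3 * del) (node (xidx u) (yidx u)))
    by (unfold box, node; simpl; rewrite !Rabs_lt_iff; lra).
  assert (B3 : box w (3 * del) u) by (unfold box; rewrite !Rabs_lt_iff; lra).
  assert (B4 : box w (3 * del) w) by (apply box_refl; lra).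
  (* Coordinates closer than [del] give the strict bound m < m' + 2, so the indices differ by at
     most one. *)
  assert (I : forall m m' (Z z z' : R), (Z + INR m * del <= z)%R ->
    (z' < Z + INR m' * del + del)%R -> (z - z' < del)%R -> (m <= S m')%nat).
  { intros m m' Z z z' H1 H2 H3.
    assert (Hlt : (INR m < INR (S (S m')))%R).
    { apply (Rmult_lt_reg_r del). exact Hdel. rewrite !S_INR. lra. }
    apply INR_lt in Hlt. lia. }
  unfold gx, gy in A1, A2, U1, U2.
  assert (E : lint k (node (xidx w) (yidx w)) (node (xidx u) (yidx u))
    = pot (xidx u) (yidx u) - pot (xidx w) (yidx w)).
  { apply lint_nodes; auto.
    - apply (I _ _ X (fst w) (fst u)); lra.
    - apply (I _ _ X (fst u) (fst w)); lra.
    - apply (I _ _ Y (snd w) (snd u)); lra.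
    - apply (I _ _ Y (snd u) (snd w)); lra. }
  assert (E1 := lint_add_near _ _ _ B1 B2 B3). assert (E2 := lint_add_near _ _ _ B1 B4 B3).
  unfold prim.
  replace (lint k w u) with (lint k (node (xidx w) (yidx w)) w + lint k w u
    - lint k (node (xidx w) (yidx w)) w) by ring.
  rewrite E2, <- E1, E. ring.
Qed.

Lemma prim_deriv : cderiv prim w (k w).
Proof.
  intros eps He.
  assert (Hn : locally (T := C_UniformSpace) w (box w del)).
  { apply locally_Cmod. exists del. split. exact Hdel. intros u Hu. split.
    - eapply Rle_lt_trans. apply (Cmod_ge_fst (u - w)). exact Hu.
    - eapply Rle_lt_trans. apply (Cmod_ge_snd (u - w)). exact Hu. }
  assert (Hk' : cont_on k (box w (3 * del))) by (intros u Hu; now apply Hk, box_nbhd).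
  generalize (filter_and _ _ Hn (lint_near k w (3 * del) ltac:(lra) Hk' eps He)).
  apply filter_imp. intros u [Hu Hest]. rewrite prim_diff by exact Hu. exact Hest.
Qed.

End Potential.

Lemma K_nbhd (w : C) : K w -> nbhd w.
Proof. intros Hw. exists w. split. exact Hw. apply box_refl. lra. Qed.

Lemma center_cell (m n m' n' : nat) : cell m n (center m' n') -> (m, n) = (m', n').
Proof.
  unfold cell, center, rect. simpl fst; simpl snd. rewrite gx_S, gy_S.
  rewrite !Rmin_left, !Rmax_right by lra. unfold gx, gy. intros [H1 H2].
  assert (A : forall i j, (INR i * del <= INR j * del + del / 2 <= INR i * del + del)%R -> i = j).
  { intros i j Hij.
    assert (G1 : (INR i < INR (S j))%R) by (apply (Rmult_lt_reg_r del); [exact Hdel | rewrite S_INR; lra]).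
    assert (G2 : (INR j < INR (S i))%R) by (apply (Rmult_lt_reg_r del); [exact Hdel | rewrite S_INR; lra]).
    apply INR_lt in G1. apply INR_lt in G2. lia. }
  rewrite (A m m'), (A n n') by lra. reflexivity.
Qed.

(* Subtracting a suitable multiple of [1 / (w - c)], with [c] the centre of a
   cell, kills the circulation around that cell and affects no other cell. *)
Lemma contour_zero_of_bad_cells (l : list (nat * nat)) :
  (forall m n, In (m, n) l ->
     ~ nbhd (center m n) /\ contour_integral (fun w => / (w - center m n)) gamma = 0) ->
  forall (k : C -> C) (H V : nat -> nat -> C),
    cont_on k nbhd -> cauchy_on k nbhd -> agrees k H V ->
    (forall m n, (m < N)%nat -> (n < N)%nat -> ~ In (m, n) l -> circ H V m n = 0) ->
    contour_integral k gamma = 0.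
Proof.
  induction l as [|[m0 n0] l IH]; intros Hl k H V Hk Hz HHV Hcirc.
  (* No bad cell is left, so [prim] is a primitive along the closed path. *)
  - rewrite (contour_ftc gamma (prim k H V) k Hgamma).
    + rewrite Hclosed. ring.
    + intros t Ht. apply prim_deriv; auto.
    + intros t Ht. apply Hk, K_nbhd. auto.
  - destruct (Hl m0 n0 (or_introl eq_refl)) as [Hc Hwind].
    set (c := center m0 n0) in *. set (g := fun w : C => / (w - c)) in *.
    assert (Hgd : forall w, w <> c -> exists d, cderiv g w d) by (intros; now apply cderiv_inv_sub).
    assert (Hgc : forall w, w <> c -> contC g w) by (intros; now apply contC_inv_sub).
    assert (Hne : forall w, nbhd w -> w <> c) by (intros w Hw ->; auto).
    assert (HJ : circ (hedge g) (vedge g) m0 n0 <> 0).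
    { rewrite circ_edges. generalize (rint_inv_center c (del / 2) ltac:(lra)).
      unfold c, center. simpl fst; simpl snd. rewrite gx_S, gy_S.
      replace (gx m0 + del / 2 - del / 2)%R with (gx m0) by ring.
      replace (gx m0 + del / 2 + del / 2)%R with (gx m0 + del)%R by field.
      replace (gy n0 + del / 2 - del / 2)%R with (gy n0) by ring.
      replace (gy n0 + del / 2 + del / 2)%R with (gy n0 + del)%R by field. auto. }
    (* This multiple gives the corrected data zero circulation around the first bad cell. *)
    set (al := circ H V m0 n0 / circ (hedge g) (vedge g) m0 n0).
    assert (Hag : forall w, w <> c -> contC (fun u => al * g u) w).
    { intros w Hw. apply limC_mult. apply limC_const. now apply Hgc. }
    assert (E : contour_integral (fun w => k w - al * g w) gamma = 0).
    { apply (IH (fun m n Hin => Hl m n (or_intror Hin)) _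
        (fun m n => H m n - al * hedge g m n) (fun m n => V m n - al * vedge g m n)).
      - intros w Hw. apply limC_minus. now apply Hk. now apply Hag, Hne.
      - intros a b c' d Hab Hcd HS.
        assert (Hgr : cont_on g (rect a b c' d)) by (intros w Hw; now apply Hgc, Hne, HS).
        assert (Hkr : cont_on k (rect a b c' d)) by (intros w Hw; now apply Hk, HS).
        assert (Har : cont_on (fun w => al * g w) (rect a b c' d))
          by (intros w Hw; now apply Hag, Hne, HS).
        assert (Hgz : rint g a b c' d = 0).
        { apply (goursat g nbhd); auto. }
        rewrite (rint_minus _ _ _ _ _ _ Hkr Har), (rint_scal _ _ _ _ _ _ Hgr),
          (Hz a b c' d Hab Hcd HS), Hgz. ring.
      - split; intros m n Hin.
        + assert (Hin' : forall x, (Rmin (gx m) (gx (S m)) <= x <= Rmax (gx m) (gx (S m)))%R ->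
            nbhd (x, gy n)) by (intros x Hx; apply Hin; rewrite gx_S in *; minmax).
          rewrite (proj1 HHV) by exact Hin. unfold hedge.
          rewrite (hint_minus k (fun u => al * g u)), hint_scal; auto.
        + assert (Hin' : forall y, (Rmin (gy n) (gy (S n)) <= y <= Rmax (gy n) (gy (S n)))%R ->
            nbhd (gx m, y)) by (intros y Hy; apply Hin; rewrite gy_S in *; minmax).
          rewrite (proj2 HHV) by exact Hin. unfold vedge.
          rewrite (vint_minus k (fun u => al * g u)), vint_scal by auto. ring.
      - intros m n Hm Hn Hin.
        replace (circ _ _ m n) with (circ H V m n - al * circ (hedge g) (vedge g) m n)
          by (unfold circ; ring).
        destruct (classic ((m0, n0) = (m, n))) as [Eq|Neq].
        + injection Eq. intros; subst m n. unfold al. field. exact HJ.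
        + rewrite (Hcirc m n) by (auto; intros [?|?]; auto).
          (* The pole [c] is interior to its own cell, so [g] is holomorphic on every other closed
             cell, neighbours included. *)
          rewrite circ_edges, (goursat g (cell m n)). ring.
          * intros w Hw. apply Hgd. intros ->. apply Neq. symmetry. now apply center_cell.
          * rewrite gx_S. lra.
          * rewrite gy_S. lra.
          * auto. }
    assert (HKne : forall t, (0 <= t <= 1)%R -> gamma t <> c) by (intros; now apply Hne, K_nbhd, HKgamma).
    rewrite contour_minus, contour_scal in E; auto.
    + rewrite Hwind in E. rewrite <- E. ring.
    + intros t Ht. now apply Hk, K_nbhd, HKgamma.
Qed.

(** A cell inside [U] has zero circulation. If the centre of a cell were within [3 * del] of [K],
    the whole cell, reaching [del / 2] further, would lie within [4 * del] and thus in [U]. So the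
    centres of the remaining cells are off [K], where the index hypothesis applies. *)
Lemma contour_zero_grid (k : C -> C) (U : C -> Prop) :
  (forall p w, K p -> box p (4 * del) w -> U w) ->
  cont_on k U -> cauchy_on k U ->
  (forall c, ~ K c -> contour_integral (fun w => / (w - c)) gamma = 0) ->
  contour_integral k gamma = 0.
Proof.
  intros HU Hk Hz Hwind.
  assert (Hsub : forall w, nbhd w -> U w).
  { intros w (p & Hp & H1 & H2). apply (HU p); auto. unfold box. lra. }
  set (good := fun q : nat * nat => forall w, cell (fst q) (snd q) w -> U w).
  set (l := filter (fun q => if excluded_middle_informative (good q) then false else true)
              (list_prod (seq 0 N) (seq 0 N))).
  apply (contour_zero_of_bad_cells l) with (H := hedge k) (V := vedge k).
  - intros m n Hin. apply filter_In in Hin. destruct Hin as [_ Hin].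
    destruct excluded_middle_informative as [|Hbad]; [discriminate|].
    assert (Hc : ~ nbhd (center m n)).
    { intros (p & Hp & H1 & H2). apply Hbad. intros w Hw. apply (HU p w Hp).
      unfold center, cell, rect, box in H1, H2, Hw |- *. simpl in H1, H2, Hw.
      rewrite gx_S, gy_S in Hw. rewrite !Rmin_left, !Rmax_right in Hw by lra.
      rewrite Rabs_lt_iff in H1, H2. rewrite !Rabs_lt_iff. lra. }
    split. exact Hc. apply Hwind. intros HKc. now apply Hc, K_nbhd.
  - intros w Hw. now apply Hk, Hsub.
  - intros a b c d Hab Hcd HS. apply Hz; auto.
  - now split.
  - intros m n Hm Hn Hin. rewrite circ_edges. apply Hz.
    + rewrite gx_S. lra.
    + rewrite gy_S. lra.
    + apply NNPP. intros Hbad. apply Hin. apply filter_In. split.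
      * apply in_prod; apply in_seq; lia.
      * destruct excluded_middle_informative as [Hg|]; [|reflexivity].
        exfalso. apply Hbad. exact Hg.
Qed.

End Grid.

Lemma cauchy_homology (gamma : R -> C) (K U : C -> Prop) (k : C -> C) (B del : R) :
  piecewise_C1 gamma -> gamma 0%R = gamma 1%R ->
  (forall t, (0 <= t <= 1)%R -> K (gamma t)) ->
  (forall w, K w -> (Cmod w <= B)%R) -> (0 < del)%R ->
  (forall p w, K p -> box p (4 * del) w -> U w) ->
  cont_on k U -> cauchy_on k U ->
  (forall c, ~ K c -> contour_integral (fun w => / (w - c)) gamma = 0) ->
  contour_integral k gamma = 0.
Proof.
  intros Hg Hcl HKg HB Hdel HU Hk Hz Hw.
  set (X := (- B - del)%R).
  (* The index plus one exceeds [2 * B / del]; two more cells give the margins, and the last unit is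
     the one subtracted in [INR N - 1]. *)
  set (N := S (S (S (S (idx (Rabs (2 * B / del))))))).
  assert (HN : (2 * B + 2 * del <= (INR N - 1) * del)%R).
  { assert (H1 := idx_spec _ (Rabs_pos (2 * B / del))). assert (H2 := Rle_abs (2 * B / del)).
    unfold N. rewrite !S_INR.
    assert (E : (2 * B = 2 * B / del * del)%R) by (field; lra). nra. }
  apply (contour_zero_grid gamma Hg Hcl K HKg X X del Hdel N) with (U := U); auto.
  intros w Hw'. specialize (HB w Hw').
  assert (H1 := Cmod_ge_fst w). assert (H2 := Cmod_ge_snd w).
  apply Rabs_le_between in H1. apply Rabs_le_between in H2. unfold X. lra.
Qed.

(** * Principal parts *)

Lemma cderiv_sub_pow (c w : C) (n : nat) :
  cderiv (fun u => (u - c) ^ S n) w (INR (S n) * (w - c) ^ n).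
Proof.
  replace (INR (S n) * (w - c) ^ n) with (INR (S n) * (w - c) ^ n * (1 + 0)) by ring.
  apply (cderiv_pow (fun u => u - c)).
  apply (cderiv_plus (fun u => u) (fun _ => - c)). apply cderiv_id. apply cderiv_const.
Qed.

Lemma cderiv_inv_pow (c w : C) (n : nat) :
  w <> c -> cderiv (fun u => / (u - c) ^ S n) w (- INR (S n) * / (w - c) ^ S (S n)).
Proof.
  intros H. assert (Hs := Cneq_sub _ _ H). assert (Hp := Cpow_nz _ n Hs).
  replace (- INR (S n) * / (w - c) ^ S (S n))
    with (- (INR (S n) * (w - c) ^ n) * / ((w - c) ^ S n * (w - c) ^ S n)).
  apply (cderiv_inv (fun u => (u - c) ^ S n)). now apply Cpow_nz. apply cderiv_sub_pow.
  rewrite !Cpow_S. field. auto.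
Qed.

Lemma contC_inv_pow (c w : C) (n : nat) : w <> c -> contC (fun u => / (u - c) ^ n) w.
Proof.
  intros H. apply limC_inv. now apply Cpow_nz, Cneq_sub.
  apply (limC_pow (fun u => u - c)). apply limC_minus. apply limC_id. apply limC_const.
Qed.

(** From exponent two on, the integrand has a single-valued primitive off [c]. *)
Lemma contour_inv_pow (gamma : R -> C) (c : C) (n : nat) :
  piecewise_C1 gamma -> gamma 0%R = gamma 1%R ->
  (forall t, (0 <= t <= 1)%R -> gamma t <> c) ->
  contour_integral (fun w => / (w - c) ^ S (S n)) gamma = 0.
Proof.
  intros Hg Hcl Hc.
  assert (HI : RtoC (INR (S n)) <> 0).
  { intros E. apply RtoC_inj in E. revert E. apply not_0_INR. discriminate. }
  rewrite (contour_ftc gamma (fun w => - / INR (S n) * / (w - c) ^ S n) _ Hg).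
  - rewrite Hcl. ring.
  - intros t Ht.
    replace (/ (gamma t - c) ^ S (S n))
      with (0 * / (gamma t - c) ^ S n
        + - / INR (S n) * (- INR (S n) * / (gamma t - c) ^ S (S n))).
    apply (cderiv_mult (fun _ => - / INR (S n)) (fun w => / (w - c) ^ S n)).
    apply cderiv_const. now apply cderiv_inv_pow, Hc.
    field. repeat split; try assumption; apply Cpow_nz, Cneq_sub; auto.
  - intros t Ht. now apply contC_inv_pow, Hc.
Qed.

(* Partial fractions in [w]: both residues of [1 / ((w - p)^n (w - z))] cancel. *)
Lemma contour_inv_pow_mult (gamma : R -> C) (p z W : C) (n : nat) :
  piecewise_C1 gamma -> gamma 0%R = gamma 1%R ->
  (forall t, (0 <= t <= 1)%R -> gamma t <> p) -> (forall t, (0 <= t <= 1)%R -> gamma t <> z) ->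
  p <> z ->
  contour_integral (fun w => / (w - p)) gamma = W ->
  contour_integral (fun w => / (w - z)) gamma = W ->
  contour_integral (fun w => / (w - p) ^ S n * / (w - z)) gamma = 0.
Proof.
  intros Hg Hcl Hp Hz Hpz HWp HWz.
  assert (Hzp : z - p <> 0) by (apply Cneq_sub; auto).
  (* This is (w - p) - (w - z) = z - p divided by (z - p) (w - p)^(m+1) (w - z). *)
  assert (step : forall m,
    contour_integral (fun w => / (w - p) ^ S m * / (w - z)) gamma =
    / (z - p) * (contour_integral (fun w => / (w - p) ^ m * / (w - z)) gamma
      - contour_integral (fun w => / (w - p) ^ S m) gamma)).
  { intros m.
    assert (C1 : forall t, (0 <= t <= 1)%R -> contC (fun w => / (w - p) ^ m * / (w - z)) (gamma t)).
    { intros t Ht. apply limC_mult. now apply contC_inv_pow, Hp. now apply contC_inv_sub, Hz. }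
    assert (C2 : forall t, (0 <= t <= 1)%R -> contC (fun w => / (w - p) ^ S m) (gamma t))
      by (intros t Ht; now apply contC_inv_pow, Hp).
    rewrite <- (contour_minus _ _ _ Hg C1 C2), <- contour_scal; auto.
    - apply contour_ext. intros t Ht. rewrite Cpow_S.
      assert (Hp' := Cneq_sub _ _ (Hp t Ht)). assert (Hz' := Cneq_sub _ _ (Hz t Ht)).
      assert (Hpp := Cpow_nz _ m Hp'). field. auto.
    - intros t Ht. apply limC_minus. now apply C1. now apply C2. }
  induction n as [|n IH].
  - rewrite step.
    rewrite (contour_ext _ (fun w => / (w - p) ^ 0 * / (w - z)) (fun w => / (w - z))).
    rewrite (contour_ext _ (fun w => / (w - p) ^ 1) (fun w => / (w - p))).
    rewrite HWp, HWz. ring.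
    + intros t Ht. now rewrite Cpow_1_r.
    + intros t Ht. simpl. field. apply Cneq_sub, Hz, Ht.
  - rewrite step, IH, contour_inv_pow; auto. ring.
Qed.

Lemma principal_part_0 (a : nat -> C) (p w : C) : principal_part 0 a p w = 0.
Proof. unfold principal_part. rewrite sum_n_m_zero by lia. reflexivity. Qed.

Lemma principal_part_S (n : nat) (a : nat -> C) (p w : C) :
  principal_part (S n) a p w = principal_part n a p w + a (S n) * / (w - p) ^ S n.
Proof. unfold principal_part. rewrite sum_n_Sm by lia. reflexivity. Qed.

Lemma cderiv_principal_part (n : nat) (a : nat -> C) (p w : C) :
  w <> p -> exists l, cderiv (principal_part n a p) w l.
Proof.
  intros H. induction n as [|n [l IH]].
  - exists 0. apply cderiv_ext with (fun _ => 0).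
    apply filter_forall. intros u. now rewrite principal_part_0. apply cderiv_const.
  - eexists. apply cderiv_ext with
      (fun u => principal_part n a p u + a (S n) * / (u - p) ^ S n).
    apply filter_forall. intros u. now rewrite principal_part_S.
    apply cderiv_plus. exact IH.
    apply (cderiv_mult (fun _ => a (S n)) (fun u => / (u - p) ^ S n)). apply cderiv_const.
    now apply cderiv_inv_pow.
Qed.

Lemma contC_principal_part (n : nat) (a : nat -> C) (p w : C) :
  w <> p -> contC (principal_part n a p) w.
Proof.
  intros H. destruct (cderiv_principal_part n a p w H) as [l Hl].
  exact (cderiv_contC _ _ _ Hl).
Qed.

Lemma contour_principal_part (gamma : R -> C) (p z W : C) (n : nat) (a : nat -> C) :
  piecewise_C1 gamma -> gamma 0%R = gamma 1%R ->
  (forall t, (0 <= t <= 1)%R -> gamma t <> p) -> (forall t, (0 <= t <= 1)%R -> gamma t <> z) ->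
  p <> z ->
  contour_integral (fun w => / (w - p)) gamma = W ->
  contour_integral (fun w => / (w - z)) gamma = W ->
  contour_integral (fun w => principal_part n a p w * / (w - z)) gamma = 0.
Proof.
  intros Hg Hcl Hp Hz Hpz HWp HWz.
  assert (Hzc : forall t, (0 <= t <= 1)%R -> contC (fun w => / (w - z)) (gamma t))
    by (intros t Ht; now apply contC_inv_sub, Hz).
  induction n as [|n IH].
  - rewrite (contour_ext _ _ (fun w => 0 * / (w - z))).
    rewrite contour_scal by assumption. ring.
    intros t Ht. now rewrite principal_part_0.
  - rewrite (contour_ext _ _ (fun w => principal_part n a p w * / (w - z)
      + a (S n) * (/ (w - p) ^ S n * / (w - z)))).
    2: intros t Ht; rewrite principal_part_S; ring.
    assert (C1 : forall t, (0 <= t <= 1)%R -> contC (fun w => / (w - p) ^ S n * / (w - z)) (gamma t)).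
    { intros t Ht. apply limC_mult. now apply contC_inv_pow, Hp. now apply Hzc. }
    rewrite (contour_plus _ (fun w => principal_part n a p w * / (w - z))), IH, contour_scal; auto.
    + rewrite (contour_inv_pow_mult gamma p z W); auto. ring.
    + intros t Ht. apply limC_mult. now apply contC_principal_part, Hp. now apply Hzc.
    + intros t Ht. apply limC_mult. apply limC_const. now apply C1.
Qed.

Lemma sum_over_cons (F : C -> C) (p : C) (l : list C) :
  sum_over F (p :: l) = F p + sum_over F l.
Proof. reflexivity. Qed.

Lemma cderiv_sum_over (G : C -> C -> C) (l : list C) (w : C) :
  (forall p, In p l -> exists d, cderiv (G p) w d) ->
  exists d, cderiv (fun u => sum_over (fun p => G p u) l) w d.
Proof.
  intros H. induction l as [|q l IH].
  - exists 0. exact (cderiv_const 0 w).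
  - destruct IH as [d1 H1]. { intros p Hp. apply H. now right. }
    destruct (H q (or_introl eq_refl)) as [d2 H2].
    eexists. exact (cderiv_plus (G q) _ _ _ _ H2 H1).
Qed.

(** Continuity of the partial sums is carried along because splitting the integral of a sum needs it
    at each stage. *)
Lemma contour_sum_over (gamma : R -> C) (G : C -> C -> C) (z : C) (l : list C) :
  piecewise_C1 gamma ->
  (forall t, (0 <= t <= 1)%R -> gamma t <> z) ->
  (forall p t, In p l -> (0 <= t <= 1)%R -> contC (G p) (gamma t)) ->
  (forall p, In p l -> contour_integral (fun w => G p w * / (w - z)) gamma = 0) ->
  contour_integral (fun w => sum_over (fun p => G p w) l * / (w - z)) gamma = 0 /\
  (forall t, (0 <= t <= 1)%R -> contC (fun w => sum_over (fun p => G p w) l) (gamma t)).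
Proof.
  intros Hg Hz Hc H.
  assert (Hzc : forall t, (0 <= t <= 1)%R -> contC (fun w => / (w - z)) (gamma t))
    by (intros t Ht; now apply contC_inv_sub, Hz).
  induction l as [|q l IH].
  - split.
    + etransitivity. exact (contour_scal gamma 0 (fun w => / (w - z)) Hg Hzc). ring.
    + intros t Ht. exact (limC_const 0).
  - destruct IH as [H1 H2].
    { intros p t Hp. apply Hc. now right. } { intros p Hp. apply H. now right. }
    split.
    + rewrite (contour_ext _ _ (fun w => G q w * / (w - z)
        + sum_over (fun p => G p w) l * / (w - z))).
      2: intros t Ht; rewrite sum_over_cons; ring.
      rewrite (contour_plus _ (fun w => G q w * / (w - z))), H1, H; auto. ring. now left.
      intros t Ht. apply limC_mult. apply Hc; auto. now left. now apply Hzc.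
      intros t Ht. apply limC_mult. now apply H2. now apply Hzc.
    + intros t Ht. apply (limC_plus (G q)). apply Hc; auto. now left. now apply H2.
Qed.

(** Without repetitions only one term of the sum can be singular at [p]. *)
Lemma sum_over_extract (G : C -> C -> C) (l : list C) (p : C) :
  NoDup l -> In p l -> (forall q, In q l -> q <> p -> contC (G q) p) ->
  exists g, (forall w, sum_over (fun q => G q w) l = G p w + g w) /\ contC g p.
Proof.
  intros Hnd Hin Hc. induction l as [|q l IH]; [destruct Hin|].
  inversion Hnd as [|? ? Hq Hnd']; subst.
  destruct (classic (q = p)) as [->|Hne].
  - exists (fun w => sum_over (fun q => G q w) l). split. reflexivity.
    assert (Hc' : forall q, In q l -> contC (G q) p).
    { intros q Hq'. apply Hc. now right. intros ->. auto. }
    clear -Hc'. induction l as [|r l IH].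
    + exact (limC_const 0).
    + apply (limC_plus (G r)). apply Hc'. now left. apply IH. intros q Hq. apply Hc'. now right.
  - destruct Hin as [|Hin]; [contradiction|].
    destruct IH as (g & Hg & Hgc); auto. { intros r Hr. apply Hc. now right. }
    exists (fun w => G q w + g w). split.
    + intros w. rewrite sum_over_cons, Hg. ring.
    + apply (limC_plus (G q)). apply Hc; auto. now left. exact Hgc.
Qed.

(** * Limits of power series at their centre *)

Lemma sum_n_S_C (a : nat -> C) (n : nat) :
  (sum_n (G := C_NormedModule) a (S n) : C) = (sum_n (G := C_NormedModule) a n : C) + a (S n).
Proof. rewrite sum_Sn. reflexivity. Qed.

Lemma series_terms_bounded (a : nat -> C) (L : C) :
  is_series (K := C_AbsRing) (V := C_NormedModule) a L ->
  exists N, forall j, (N <= j)%nat -> (Cmod (a j) <= 1)%R.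
Proof.
  intros Hs. assert (Hl := proj2 (limC_filterlim eventually _ _) Hs).
  assert (Hhalf : (0 < / 2)%R) by lra.
  destruct (Hl _ Hhalf) as [N HN]. exists (S N). intros [|j] Hj; [lia|].
  assert (A1 := HN j ltac:(lia)). assert (A2 := HN (S j) ltac:(lia)).
  rewrite sum_n_S_C in A2. revert A1 A2. generalize (sum_n (G := C_NormedModule) a j : C).
  intros s A1 A2. replace (a (S j)) with ((s + a (S j) - L) - (s - L)) by ring.
  eapply Rle_trans. apply Cmod_sub_le. lra.
Qed.

(** Convergence at distance r/2 bounds the coefficients geometrically, and for w within r/4 of p the
    terms after the first are dominated by a geometric series of ratio at most 1/2. *)
Lemma power_series_limit (b : nat -> C) (p : C) (G : C -> C) (r : R) :
  (0 < r)%R ->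
  (forall w, (0 < Cmod (w - p) < r)%R ->
     is_series (K := C_AbsRing) (V := C_NormedModule) (fun j => b j * (w - p) ^ j) (G w)) ->
  limC (locally' (T := C_UniformSpace) p) G (b O).
Proof.
  intros Hr H.
  assert (HM : exists M, (0 < M)%R /\ forall j, (Cmod (b j) * (r / 2) ^ j <= M)%R).
  { assert (Hw : (p + RtoC (r / 2)) - p = RtoC (r / 2)) by ring.
    assert (Hs := H (p + RtoC (r / 2))). rewrite Hw, Cmod_R, Rabs_pos_eq in Hs by lra.
    specialize (Hs ltac:(lra)).
    destruct (series_terms_bounded _ _ Hs) as [N HN].
    assert (HB : exists M, (0 < M)%R /\ forall j, (j < N)%nat -> (Cmod (b j) * (r / 2) ^ j <= M)%R).
    { clear HN. induction N as [|N (M & HM & IH)].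
      - exists 1%R. split. lra. intros; lia.
      - exists (M + Cmod (b N) * (r / 2) ^ N)%R.
        assert (0 <= Cmod (b N) * (r / 2) ^ N)%R.
        { apply Rmult_le_pos. apply Cmod_ge_0. apply pow_le. lra. }
        split. lra. intros j Hj. destruct (Nat.eq_dec j N) as [->|Hn]. lra.
        specialize (IH j ltac:(lia)). lra. }
    destruct HB as (M & HM & HB). exists (M + 1)%R. split. lra.
    intros j. destruct (Nat.lt_ge_cases j N) as [Hj|Hj].
    - specialize (HB j Hj). lra.
    - specialize (HN j Hj).
      rewrite Cmod_mult, Cmod_pow, Cmod_R, Rabs_pos_eq in HN by lra. lra. }
  destruct HM as (M & HM & Hb).
  intros eps He. apply locally'_Cmod.
  (* The bound below is [2 * M * q = 4 * M / r * Cmod u], which this radius keeps under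
     [eps / 2]. *)
  exists (Rmin (r / 4) (eps * r / (8 * M))). split.
  { apply Rmin_case. lra. apply Rdiv_lt_0_compat; nra. }
  intros w [Hw0 Hw].
  assert (Hw1 : (Cmod (w - p) < r / 4)%R) by (eapply Rlt_le_trans; [exact Hw | apply Rmin_l]).
  assert (Hw2 : (Cmod (w - p) < eps * r / (8 * M))%R) by (eapply Rlt_le_trans; [exact Hw | apply Rmin_r]).
  assert (Hs := H w ltac:(lra)).
  set (u := w - p) in *. set (q := (Cmod u / (r / 2))%R).
  assert (Hq0 : (0 <= q)%R) by (apply Rlt_le, Rdiv_lt_0_compat; lra).
  assert (Hqe : (Cmod u = q * (r / 2))%R) by (unfold q; field; lra).
  assert (Hq1 : (q <= / 2)%R).
  { apply (Rmult_le_reg_r (r / 2)). lra. rewrite <- Hqe. lra. }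
  set (T := fun j => b j * u ^ j) in Hs.
  assert (Hterm : forall j, (Cmod (T j) <= M * q ^ j)%R).
  { intros j. unfold T. rewrite Cmod_mult, Cmod_pow, Hqe, Rpow_mult_distr.
    replace (Cmod (b j) * (q ^ j * (r / 2) ^ j))%R
      with (Cmod (b j) * (r / 2) ^ j * q ^ j)%R by ring.
    apply Rmult_le_compat_r. now apply pow_le. apply Hb. }
  (* The factor [1 - (/ 2) ^ n] leaves exactly the room for the next term, at most
     [M * q * (/ 2) ^ n]. *)
  assert (Hpart : forall n, (Cmod (sum_n (G := C_NormedModule) T n - b O)
     <= 2 * M * q * (1 - (/ 2) ^ n))%R).
  { induction n as [|n IH].
    - rewrite sum_O. unfold T. simpl. replace (b O * 1 - b O) with (RtoC 0) by ring. rewrite Cmod_0. lra.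
    - rewrite sum_n_S_C. revert IH.
      generalize (sum_n (G := C_NormedModule) T n : C). intros s IH.
      replace (s + T (S n) - b O) with ((s - b O) + T (S n)) by ring.
      eapply Rle_trans. apply Cmod_triangle.
      eapply Rle_trans. apply Rplus_le_compat. exact IH. apply Hterm.
      assert (Hqn : (q ^ n <= (/ 2) ^ n)%R) by (apply pow_incr; lra).
      simpl.
      assert (M * (q * q ^ n) <= M * (q * (/ 2) ^ n))%R.
      { apply Rmult_le_compat_l. lra. now apply Rmult_le_compat_l. }
      nra. }
  assert (Hlim := proj2 (limC_filterlim eventually _ (G w)) Hs).
  assert (Hfin : (Cmod (G w - b O) <= 2 * M * q)%R).
  { apply Rnot_lt_le. intros Hlt.
    assert (Hd : (0 < Cmod (G w - b O) - 2 * M * q)%R) by lra.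
    destruct (Hlim _ Hd) as [N HN]. specialize (HN N (Nat.le_refl N)).
    specialize (Hpart N).
    set (s := sum_n (G := C_NormedModule) T N : C) in *.
    assert (Ht := Cmod_triangle (G w - s) (s - b O)).
    replace (G w - s + (s - b O)) with (G w - b O) in Ht by ring.
    rewrite (Cmod_sub_sym (G w) s) in Ht.
    assert (0 <= 2 * M * q * (/ 2) ^ N)%R.
    { apply Rmult_le_pos. nra. apply pow_le. lra. }
    lra. }
  eapply Rle_lt_trans. exact Hfin. unfold q.
  apply (Rmult_lt_compat_l (4 * M / r)) in Hw2. 2: apply Rdiv_lt_0_compat; lra.
  replace (4 * M / r * (eps * r / (8 * M)))%R with (eps / 2)%R in Hw2 by (field; lra).
  replace (2 * M * (Cmod u / (r / 2)))%R with (4 * M / r * Cmod u)%R by (field; lra). lra.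
Qed.

(** * Removable singularities *)

Lemma locally'_not_In (l : list C) (w : C) :
  locally' (T := C_UniformSpace) w (fun u => ~ In u l).
Proof.
  induction l as [|p l IH].
  - apply filter_forall. intros u [].
  - destruct (classic (p = w)) as [->|Hp].
    + generalize (filter_and _ _ (locally'_neq w) IH). apply filter_imp.
      intros u [H1 H2] [E|Hin]; [|auto]. apply H1. rewrite E. ring.
    + assert (Hn : locally' (T := C_UniformSpace) w (fun u => u <> p)).
      { apply locally'_Cmod. exists (Cmod (p - w)). split. now apply Cmod_sub_pos.
        intros u [_ Hu] ->. lra. }
      generalize (filter_and _ _ Hn IH). apply filter_imp. intros u [H1 H2] [E|Hin]; auto.
Qed.

Lemma locally_not_In (l : list C) (w : C) :
  ~ In w l -> locally (T := C_UniformSpace) w (fun u => ~ In u l).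
Proof.
  intros Hw. generalize (locally'_not_In l w). unfold locally', within. apply filter_imp.
  intros u Hu. destruct (classic (u = w)) as [->|H]; auto.
Qed.

(** Points of [l] receive the limit of [k0], picked by [epsilon], and thus an arbitrary value where
    no limit exists; inside [U] it does exist. Continuity there is all that the Cauchy property on
    rectangles requires. *)
Lemma removable_singularities (k0 : C -> C) (U : C -> Prop) (l : list C) :
  (forall w, U w -> ~ In w l -> exists d, cderiv k0 w d) ->
  (forall w, U w -> In w l -> exists L, limC (locally' (T := C_UniformSpace) w) k0 L) ->
  exists k, (forall w, ~ In w l -> k w = k0 w) /\ cont_on k U /\ cauchy_on k U.
Proof.
  intros Hd HL.
  set (k := fun w => if excluded_middle_informative (In w l)
    then epsilon (inhabits (RtoC 0)) (fun L => limC (locally' (T := C_UniformSpace) w) k0 L)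
    else k0 w).
  assert (Hout : forall w, ~ In w l -> k w = k0 w).
  { intros w Hw. unfold k. destruct excluded_middle_informative; [contradiction | reflexivity]. }
  assert (Hc : cont_on k U).
  { intros w Hw. destruct (classic (In w l)) as [Hin|Hin].
    - apply contC_of_punctured. apply limC_ext with k0.
      + generalize (locally'_not_In l w). apply filter_imp. intros u Hu. symmetry. now apply Hout.
      + unfold k at 1. destruct excluded_middle_informative as [_|]; [|contradiction].
        apply epsilon_spec. now apply HL.
    - apply contC_ext with k0.
      + generalize (locally_not_In l w Hin). apply filter_imp. intros u Hu. symmetry. now apply Hout.
      + destruct (Hd w Hw Hin) as [d Hd']. exact (cderiv_contC _ _ _ Hd'). }
  exists k. repeat split; auto.
  apply (cauchy_on_remove_points k U l Hc). apply goursat.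
  intros w [Hw Hin]. destruct (Hd w Hw Hin) as [d Hd']. exists d.
  apply cderiv_ext with k0; auto.
  generalize (locally_not_In l w Hin). apply filter_imp. intros u Hu. symmetry. now apply Hout.
Qed.

(** * The closure of a region bounded by a path *)

Lemma boundary_closed (D : C -> Prop) (w : C) :
  ~ D w -> ~ boundary D w ->
  exists e, (0 < e)%R /\ forall u, (Cmod (u - w) < e)%R -> ~ D u /\ ~ boundary D u.
Proof.
  intros HD HB.
  assert (He : exists e, (0 < e)%R /\ forall u, (Cmod (u - w) < e)%R -> ~ D u).
  { apply NNPP. intros Hn. apply HB. intros eps Heps. split.
    - apply NNPP. intros Hn'. apply Hn. exists eps. split. exact Heps.
      intros u Hu Du. apply Hn'. now exists u.
    - exists w. split; auto. replace (w - w) with (RtoC 0) by ring. now rewrite Cmod_0. }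
  destruct He as (e & He & H). exists e. split. exact He. intros u Hu. split. now apply H.
  intros Hb. destruct (Hb (e - Cmod (u - w))%R ltac:(lra)) as [(v & Hv & Dv) _].
  apply (H v); auto.
  replace (v - w) with ((v - u) + (u - w)) by ring.
  eapply Rle_lt_trans. apply Cmod_triangle. lra.
Qed.

Lemma open_not_boundary (D : C -> Prop) (w : C) :
  open (T := C_UniformSpace) D -> D w -> ~ boundary D w.
Proof.
  intros Ho HD HB. assert (Hl := Ho w HD). rewrite locally_Cmod in Hl.
  destruct Hl as (d & Hd & H). destruct (HB d Hd) as [_ (u & Hu & Du)]. auto.
Qed.

(** This is a Lebesgue number argument by [rect_induction]: a radius that serves the part of [K] in
    a rectangle is the least of the radii for its quarters. Near a point off the closed set [K] the
    claim is vacuous. *)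
Lemma uniform_nbhd (K U : C -> Prop) (B : R) :
  (forall w, K w -> (Cmod w <= B)%R) ->
  (forall w, ~ K w -> exists e, (0 < e)%R /\ forall u, (Cmod (u - w) < e)%R -> ~ K u) ->
  (forall w, K w -> locally (T := C_UniformSpace) w U) ->
  exists del, (0 < del)%R /\ forall p w, K p -> box p (4 * del) w -> U w.
Proof.
  intros HB Hcl HU.
  destruct (classic (exists p, K p)) as [[p0 Hp0]|Hno].
  2:{ exists 1%R. split. lra. intros p w Hp. exfalso. eauto. }
  assert (HB0 : (0 <= B)%R) by (eapply Rle_trans; [apply Cmod_ge_0 | exact (HB p0 Hp0)]).
  destruct (rect_induction (fun a b c d => exists del, (0 < del)%R /\
    forall p w, K p -> rect a b c d p -> box p (4 * del) w -> U w) (- B) B (- B) B) as (del & Hdel & H).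
  - lra.
  - lra.
  - intros a b c d Ha Hb Hc Hd (d1 & D1 & H1) (d2 & D2 & H2) (d3 & D3 & H3) (d4 & D4 & H4).
    exists (Rmin (Rmin d1 d2) (Rmin d3 d4)). split.
    repeat apply Rmin_case; assumption.
    intros p w Hp Hr [Bx By].
    assert (L1 := Rmin_l (Rmin d1 d2) (Rmin d3 d4)). assert (L2 := Rmin_r (Rmin d1 d2) (Rmin d3 d4)).
    assert (L3 := Rmin_l d1 d2). assert (L4 := Rmin_r d1 d2).
    assert (L5 := Rmin_l d3 d4). assert (L6 := Rmin_r d3 d4).
    assert (BB : forall d', (Rmin (Rmin d1 d2) (Rmin d3 d4) <= d')%R -> box p (4 * d') w)
      by (intros d' Hd'; split; lra).
    unfold rect in *. rewrite Rmin_left, Rmax_right, Rmin_left, Rmax_right in Hr by lra.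
    destruct (Rle_dec (fst p) ((a + b) / 2)), (Rle_dec (snd p) ((c + d) / 2)).
    + apply (H1 p); auto; [|apply BB; lra].
      rewrite Rmin_left, Rmax_right, Rmin_left, Rmax_right; lra.
    + apply (H3 p); auto; [|apply BB; lra].
      rewrite Rmin_left, Rmax_right, Rmin_left, Rmax_right; lra.
    + apply (H2 p); auto; [|apply BB; lra].
      rewrite Rmin_left, Rmax_right, Rmin_left, Rmax_right; lra.
    + apply (H4 p); auto; [|apply BB; lra].
      rewrite Rmin_left, Rmax_right, Rmin_left, Rmax_right; lra.
  - intros x y Hx Hy.
    assert (Hnear : exists e, (0 < e)%R /\ forall p w, K p ->
      (Cmod (p - (x, y)) < e)%R -> (Cmod (w - p) < e)%R -> U w).
    { destruct (classic (K (x, y))) as [Hk|Hk].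
      - assert (Hl := HU _ Hk). rewrite locally_Cmod in Hl. destruct Hl as (e & He & Hl).
        exists (e / 2)%R. split. lra. intros p w _ H1 H2. apply Hl.
        replace (w - (x, y)) with ((w - p) + (p - (x, y))) by ring.
        eapply Rle_lt_trans. apply Cmod_triangle. lra.
      - destruct (Hcl _ Hk) as (e & He & Hl). exists e. split. exact He.
        intros p w Hp H1 _. exfalso. now apply (Hl p). }
    destruct Hnear as (e & He & Hn). exists (e / 2)%R. split. lra.
    (* A box of radius [4 * (e / 8)] has points at distance less than [e] from its centre, the two
       coordinates contributing [e / 2] each. *)
    intros a b c d _ _ _ _ Hax Hcy Hab Hcd. exists (e / 8)%R. split. lra.
    intros p w Hp Hr [Bx By]. apply (Hn p w Hp).
    + eapply Rle_lt_trans. apply (Cmod_rect a b c d (x, y) p); try lra; [minmax | exact Hr]. lra.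
    + eapply Rle_lt_trans. apply (Cmod_le_abs (fst w - fst p) (snd w - snd p)). lra.
  - exists del. split. exact Hdel. intros p w Hp. apply H; auto.
    assert (H1 := Cmod_ge_fst p). assert (H2 := Cmod_ge_snd p). assert (H3 := HB p Hp).
    apply Rabs_le_between in H1. apply Rabs_le_between in H2.
    unfold rect. rewrite Rmin_left, Rmax_right by lra. lra.
Qed.

Lemma two_pi_i_neq_0 : 2 * PI * Ci <> 0.
Proof.
  assert (Hpi := PI_RGT_0).
  intros E. apply (f_equal (snd : C -> R)) in E. simpl in E. lra.
Qed.

Lemma winding_contour (gamma : R -> C) (z W : C) :
  winding_number gamma z = W -> contour_integral (fun w => / (w - z)) gamma = 2 * PI * Ci * W.
Proof.
  intros <-. unfold winding_number.
  set (I := contour_integral _ _). assert (H := two_pi_i_neq_0). field.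
  repeat split; intros E; apply H; rewrite E; ring.
Qed.

Lemma path_bounded (gamma : R -> C) :
  piecewise_C1 gamma -> exists B, (0 <= B)%R /\ forall t, (0 <= t <= 1)%R -> (Cmod (gamma t) <= B)%R.
Proof.
  intros [Hg _].
  destruct (contR_bounded (fun s => gamma (clamp 0 1 s)) 0 1) as (B & HB & H).
  - lra.
  - intros t _. apply contR_clamp; auto. lra.
  - exists B. split. exact HB. intros t Ht. specialize (H t Ht).
    replace (clamp 0 1 t) with t in H; [exact H|]. unfold clamp. minmax.
Qed.

(* The winding number tends to zero at infinity. *)
Lemma winding_one_bounded (gamma : R -> C) :
  piecewise_C1 gamma -> exists B, (0 <= B)%R /\
    (forall t, (0 <= t <= 1)%R -> (Cmod (gamma t) <= B)%R) /\
    forall z, winding_number gamma z = 1 -> (Cmod z <= B)%R.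
Proof.
  intros Hg. destruct (path_bounded gamma Hg) as (B & HB & Hb).
  destruct (contour_bound gamma Hg) as (L & HL & Hint).
  (* Beyond this radius the integrand is below [1 / L] in the case [L > 0], so the integral is less
     than 1 and cannot be 2 pi i. *)
  exists (B + L)%R. split. lra. split. intros t Ht. specialize (Hb t Ht). lra.
  intros z Hw. apply Rnot_lt_le. intros Hlt.
  assert (Hd : forall t, (0 <= t <= 1)%R -> (Cmod z - B <= Cmod (gamma t - z))%R).
  { intros t Ht. specialize (Hb t Ht). rewrite Cmod_sub_sym.
    generalize (Cmod_sub_ge z (gamma t)). lra. }
  assert (Hne : forall t, (0 <= t <= 1)%R -> gamma t - z <> 0).
  { intros t Ht. apply Cmod_gt_0. specialize (Hd t Ht). lra. }
  assert (H := Hint (fun w => / (w - z)) (/ (Cmod z - B))%R).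
  rewrite (winding_contour gamma z 1 Hw) in H.
  assert (Hpi := PI2_1).
  assert (HL2 : (Cmod (2 * PI * Ci * 1) <= L * / (Cmod z - B))%R).
  { apply H.
    - intros t Ht. apply contC_inv_sub. intros E. apply (Hne t Ht). rewrite E. ring.
    - apply Rlt_le, Rinv_0_lt_compat. lra.
    - intros t Ht. rewrite Cmod_inv by auto. apply Rinv_le_contravar. lra. auto. }
  rewrite !Cmod_mult, Cmod_Ci, !Cmod_R, Rabs_R1, !Rabs_pos_eq in HL2 by lra.
  apply (Rmult_le_compat_r (Cmod z - B)) in HL2. 2: lra.
  replace (L * / (Cmod z - B) * (Cmod z - B))%R with L in HL2 by (field; lra). nra.
Qed.

Lemma ex_derive_cderiv (f : C -> C) (z : C) :
  ex_derive (K := C_AbsRing) (V := C_NormedModule) f z -> exists l, cderiv f z l.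
Proof. intros [l Hl]. exists l. now apply is_derive_cderiv. Qed.

(** * The residual Cauchy formula and the power series *)

Section Main.

Context (f : C -> C) (hf : meromorphic f).
Context (o : C -> nat) (a : C -> nat -> C).
Context (hoa : forall p : C, is_pole f p -> pole_data f p (o p) (a p)).
Context (Omega : C -> Prop) (hopen : open (T := C_UniformSpace) Omega).
Context (gamma : R -> C) (hgamma : bounds_ccw gamma Omega).
Context (hbd : forall w : C, boundary Omega w -> ~ is_pole f w).
Context (poles : list C) (hnodup : NoDup poles).
Context (hpoles : forall p : C, In p poles <-> is_pole f p /\ Omega p).

Lemma path_on_boundary (t : R) : (0 <= t <= 1)%R -> boundary Omega (gamma t).
Proof. intros Ht. apply hgamma. now exists t. Qed.

Lemma path_not_in_region (t : R) (z : C) : (0 <= t <= 1)%R -> Omega z -> gamma t <> z.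
Proof.
  intros Ht Hz E. apply (open_not_boundary Omega z hopen Hz). rewrite <- E.
  now apply path_on_boundary.
Qed.

Lemma contC_on_path (t : R) : (0 <= t <= 1)%R -> contC f (gamma t).
Proof.
  intros Ht. destruct (ex_derive_cderiv f (gamma t)) as [l Hl].
  apply hf, hbd, path_on_boundary, Ht. exact (cderiv_contC _ _ _ Hl).
Qed.

(** Removing the principal part at [p] leaves a power series with limit [b 0], and the other
    principal parts are continuous at [p]. *)
Lemma principal_parts_residual (p : C) :
  In p poles -> exists L, limC (locally' (T := C_UniformSpace) p)
    (fun w => f w - sum_over (fun q => principal_part (o q) (a q) q w) poles) L.
Proof.
  intros Hp.
  destruct (sum_over_extract (fun q => principal_part (o q) (a q) q) poles p hnodup Hp) as (g & Hg & Hgc).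
  { intros q _ Hq. apply contC_principal_part. auto. }
  destruct (hoa p) as (_ & _ & b & r & Hr & Hs). now apply hpoles.
  exists (b O - g p).
  apply limC_ext with (fun w => (f w - principal_part (o p) (a p) p w) - g w).
  { apply filter_forall. intros w. rewrite Hg. ring. }
  apply limC_minus. now apply (power_series_limit b p _ r). now apply limC_locally'.
Qed.

Lemma cauchy_formula_residual (z : C) : Omega z -> ~ is_pole f z ->
  cauchy_transform f gamma z
  = f z - sum_over (fun q => principal_part (o q) (a q) q z) poles.
Proof.
  intros Hz Hnz.
  destruct hgamma as (Hg & Hcl & Hbdry & Hin & Hout).
  set (S := fun w => sum_over (fun q => principal_part (o q) (a q) q w) poles).
  (* Here [h] is a number, the value at [z] of the function f - S with all principal parts removed;
     [k0] is the difference quotient of that function. *)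
  set (h := f z - S z).
  assert (HSd : forall w, ~ In w poles -> exists d, cderiv S w d).
  { intros w Hw. apply cderiv_sum_over. intros p Hp. apply cderiv_principal_part.
    intros ->. auto. }
  assert (Hzp : ~ In z poles) by (rewrite hpoles; tauto).
  set (k0 := fun w => (f w - S w - h) / (w - z)).
  (* Only the poles in Omega become removable in [k0], so those elsewhere are excluded from [U]. *)
  set (U := fun w => ~ is_pole f w \/ In w poles).
  destruct (removable_singularities k0 U (z :: poles)) as (k & Hk0 & Hkc & Hkz).
  { intros w Hw Hnin.
    assert (Hwz : w <> z) by (intros ->; apply Hnin; now left).
    assert (Hwp : ~ In w poles) by (intros Hp; apply Hnin; now right).
    destruct Hw as [Hw|]; [|contradiction].
    destruct (ex_derive_cderiv f w) as [d1 D1]. now apply hf.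
    destruct (HSd w Hwp) as [d2 D2]. destruct (cderiv_inv_sub z w Hwz) as [d3 D3].
    eexists. apply (cderiv_mult (fun u => f u - S u - h) (fun u => / (u - z))); [|exact D3].
    apply (cderiv_plus (fun u => f u - S u) (fun _ => - h)); [|apply cderiv_const].
    apply cderiv_ext with (fun u => f u + - (1) * S u).
    { apply filter_forall. intros u. ring. }
    apply cderiv_plus. exact D1. apply (cderiv_mult (fun _ => - (1))). apply cderiv_const. exact D2. }
  { intros w _ [<-|Hp].
    - destruct (ex_derive_cderiv f z) as [d1 D1]. now apply hf.
      destruct (HSd z Hzp) as [d2 D2].
      (* At [z] the quotient tends to the derivative of f - S. *)
      exists (d1 - d2). apply limC_ext with (fun u => (f u - f z) / (u - z) - (S u - S z) / (u - z)).
      { generalize (locally'_neq z). apply filter_imp. intros u Hu. unfold k0, h. now field. }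
      apply limC_minus; now apply cderiv_quotient.
    - destruct (principal_parts_residual w Hp) as [L HL].
      exists ((L - h) / (w - z)). apply limC_div.
      + apply Cneq_sub. intros ->. auto.
      + apply limC_minus. exact HL. apply limC_const.
      + apply limC_minus. apply limC_locally', limC_id. apply limC_const. }
  set (K := fun w => Omega w \/ boundary Omega w).
  (* Boundedness of Omega is extracted from the index, which is 1 on all of it. *)
  destruct (winding_one_bounded gamma Hg) as (B & HB & HBg & HBz).
  assert (HKB : forall w, K w -> (Cmod w <= B)%R).
  { intros w [Hw|Hw]. now apply HBz, Hin. apply Hbdry in Hw. destruct Hw as (t & Ht & <-). auto. }
  destruct (uniform_nbhd K U B HKB) as (del & Hdel & HU).
  { intros w Hw. destruct (boundary_closed Omega w) as (e & He & H).
    intros Hw'. apply Hw. now left. intros Hw'. apply Hw. now right.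
    exists e. split. exact He. intros u Hu Ku. specialize (H u Hu). destruct Ku; tauto. }
  { intros w Hw.
    assert (HUw : U w).
    { destruct (classic (is_pole f w)) as [Hp|Hp]; [|now left]. right. apply hpoles.
      split. exact Hp. destruct Hw as [Hw|Hw]. exact Hw. exfalso. now apply (hbd w). }
    (* Poles are isolated, so a neighbourhood of a point of the closure contains no further pole. *)
    generalize (proj1 hf w). unfold locally', within. apply filter_imp. intros u Hu.
    destruct (classic (u = w)) as [->|Hne]. exact HUw. left. auto. }
  assert (HI : contour_integral k gamma = 0).
  { apply (cauchy_homology gamma K U k B del); auto.
    - intros t Ht. right. now apply path_on_boundary.
    - intros c Hc. rewrite (winding_contour gamma c 0). ring.
      apply Hout; intros Hc'; apply Hc; [now left | now right]. }
  assert (Hgz : forall t, (0 <= t <= 1)%R -> gamma t <> z)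
    by (intros t Ht; now apply path_not_in_region).
  assert (HW : contour_integral (fun w => / (w - z)) gamma = 2 * PI * Ci).
  { rewrite (winding_contour gamma z 1). ring. now apply Hin. }
  destruct (contour_sum_over gamma (fun q => principal_part (o q) (a q) q) z poles Hg Hgz) as [HS0 HSc].
  { intros p t Hp Ht. apply contC_principal_part. apply path_not_in_region; auto. now apply hpoles. }
  { intros p Hp. assert (Hp' := Hp). apply hpoles in Hp'. destruct Hp' as [_ HpO].
    apply (contour_principal_part gamma p z (2 * PI * Ci)); auto.
    - intros t Ht. now apply path_not_in_region.
    - intros ->. auto.
    - rewrite (winding_contour gamma p 1). ring. now apply Hin. }
  change (contour_integral (fun w => S w * / (w - z)) gamma = 0) in HS0.
  change (forall t, (0 <= t <= 1)%R -> contC S (gamma t)) in HSc.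
  assert (Hzc : forall t, (0 <= t <= 1)%R -> contC (fun w => / (w - z)) (gamma t))
    by (intros t Ht; now apply contC_inv_sub, Hgz).
  assert (Hfc : forall t, (0 <= t <= 1)%R -> contC (fun w => f w / (w - z)) (gamma t))
    by (intros t Ht; apply limC_mult; [now apply contC_on_path | now apply Hzc]).
  assert (HSz : forall t, (0 <= t <= 1)%R -> contC (fun w => S w * / (w - z)) (gamma t))
    by (intros t Ht; apply limC_mult; [now apply HSc | now apply Hzc]).
  (* The path avoids [z] and the poles, so the values filled in by [removable_singularities] do not
     enter the integral. *)
  rewrite (contour_ext gamma k (fun w => (f w / (w - z) - S w * / (w - z)) - h * / (w - z))) in HI.
  2:{ intros t Ht. rewrite Hk0.
      unfold k0. field. now apply Cneq_sub, Hgz.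
      intros [E|Hp]. now apply (Hgz t Ht). apply (path_not_in_region t (gamma t) Ht); auto.
      now apply hpoles. }
  rewrite (contour_minus gamma (fun w => f w / (w - z) - S w * / (w - z))) in HI; auto.
  - rewrite (contour_minus gamma (fun w => f w / (w - z))), (contour_scal gamma h), HS0, HW in HI; auto.
    unfold cauchy_transform.
    match goal with |- ?l = _ => change (l = h) end.
    replace (contour_integral (fun w => f w / (w - z)) gamma) with (h * (2 * PI * Ci)).
    + assert (Hpi := two_pi_i_neq_0). field.
      repeat split; intros E; apply Hpi; rewrite E; ring.
    + assert (A : forall x y : C, x - 0 - y = 0 -> y = x).
      { intros x y H. replace y with (x - 0 - (x - 0 - y)) by ring. rewrite H. ring. }
      exact (A _ _ HI).
  - intros t Ht. apply limC_minus. now apply Hfc. now apply HSz.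
  - intros t Ht. apply limC_mult. apply limC_const. now apply Hzc.
Qed.

(** The ratio z / w must be below 1 in modulus uniformly on the path, which is why the least modulus
    on the boundary governs the expansion. A finite geometric sum with explicit remainder replaces
    the exchange of series and integral. *)
Lemma cauchy_transform_expansion (m : R) (z : C) :
  (forall w, boundary Omega w -> (m <= Cmod w)%R) -> (Cmod z < m)%R ->
  is_series (K := C_AbsRing) (V := C_NormedModule)
    (fun j : nat => z ^ j *
       (/ (2 * PI * Ci) * contour_integral (fun w => f w / w ^ (j + 1)) gamma))
    (cauchy_transform f gamma z).
Proof.
  intros Hm Hzm.
  destruct hgamma as (Hg & _ & _ & _ & _).
  assert (Hz0 := Cmod_ge_0 z).
  assert (Hmt : forall t, (0 <= t <= 1)%R -> (m <= Cmod (gamma t))%R)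
    by (intros t Ht; now apply Hm, path_on_boundary).
  assert (H0 : forall t, (0 <= t <= 1)%R -> gamma t <> 0).
  { intros t Ht. apply Cmod_gt_0. specialize (Hmt t Ht). lra. }
  assert (Hz : forall t, (0 <= t <= 1)%R -> gamma t <> z).
  { intros t Ht E. specialize (Hmt t Ht). rewrite E in Hmt. lra. }
  assert (Hpc : forall n t, (0 <= t <= 1)%R -> contC (fun w => / w ^ n) (gamma t)).
  { intros n t Ht. apply limC_inv. now apply Cpow_nz, H0.
    apply (limC_pow (fun u => u)). apply limC_id. }
  set (ka := / (2 * PI * Ci)).
  (* Remainder after n terms: f(w) (z/w)^n / (w - z). Lowering n by one splits off one term of the
     series. *)
  set (Rem := fun n w => f w * (z ^ n * (/ w ^ n * / (w - z)))).
  assert (HRc : forall n t, (0 <= t <= 1)%R -> contC (Rem n) (gamma t)).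
  { intros n t Ht. apply limC_mult. now apply contC_on_path.
    apply limC_mult. apply limC_const. apply limC_mult. now apply Hpc.
    now apply contC_inv_sub, Hz. }
  assert (Hterm : forall n t, (0 <= t <= 1)%R -> contC (fun w => f w / w ^ (n + 1)) (gamma t)).
  { intros n t Ht. apply limC_mult. now apply contC_on_path. now apply Hpc. }
  assert (step : forall n, contour_integral (Rem n) gamma =
    z ^ n * contour_integral (fun w => f w / w ^ (n + 1)) gamma
    + contour_integral (Rem (S n)) gamma).
  { intros n. rewrite <- contour_scal by auto.
    rewrite <- (contour_plus gamma (fun w => z ^ n * (f w / w ^ (n + 1)))); auto.
    - apply contour_ext. intros t Ht. unfold Rem. rewrite Nat.add_1_r, !Cpow_S.
      assert (Hn := Cpow_nz _ n (H0 t Ht)). assert (Hz' := Cneq_sub _ _ (Hz t Ht)).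
      assert (H0' := H0 t Ht). field. auto.
    - intros t Ht. apply limC_mult. apply limC_const. now apply Hterm. }
  set (T := fun j : nat => z ^ j * (ka * contour_integral (fun w => f w / w ^ (j + 1)) gamma)).
  assert (Hsum : forall n, (sum_n (G := C_NormedModule) T n : C) =
    cauchy_transform f gamma z - ka * contour_integral (Rem (S n)) gamma).
  { assert (HR0 : cauchy_transform f gamma z = ka * contour_integral (Rem O) gamma).
    { unfold cauchy_transform. fold ka. f_equal. apply contour_ext. intros t Ht.
      unfold Rem. simpl. field. now apply Cneq_sub, Hz. }
    induction n as [|n IH].
    - rewrite sum_O, HR0, (step O). unfold T. ring.
    - rewrite sum_n_S_C, IH, (step (S n)). unfold T. ring. }
  apply (limC_filterlim eventually (sum_n (G := C_NormedModule) T)).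
  destruct (contour_bound gamma Hg) as (L & HL & Hint).
  (* Clamping makes f along the path continuous on the whole line, so compactness of [[0, 1]] bounds
     it. *)
  destruct (contR_bounded (fun s => f (gamma (clamp 0 1 s))) 0 1 ltac:(lra)) as (M & HM & HfM).
  { intros t Ht. apply (limC_comp (locally t) (fun s => gamma (clamp 0 1 s)) f).
    apply locally_filter. apply contR_clamp. lra. apply Hg.
    apply contC_on_path. unfold clamp. minmax. }
  assert (HfM' : forall t, (0 <= t <= 1)%R -> (Cmod (f (gamma t)) <= M)%R).
  { intros t Ht. specialize (HfM t Ht). replace (clamp 0 1 t) with t in HfM; [exact HfM|].
    unfold clamp. minmax. }
  set (q := (Cmod z / m)%R).
  assert (Hq0 : (0 <= q)%R) by (apply Rmult_le_pos; [lra | apply Rlt_le, Rinv_0_lt_compat; lra]).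
  assert (Hq1 : (q < 1)%R).
  { apply (Rmult_lt_reg_r m). lra. unfold q, Rdiv. rewrite Rmult_assoc, Rinv_l; lra. }
  assert (Hbound : forall n, (Cmod (contour_integral (Rem n) gamma) <= L * (M * (q ^ n * / (m - Cmod z))))%R).
  { intros n.
    assert (Hqn : (0 <= q ^ n)%R) by now apply pow_le.
    assert (Hi : (0 < / (m - Cmod z))%R) by (apply Rinv_0_lt_compat; lra).
    apply Hint; auto.
    - apply Rmult_le_pos; [exact HM|]. apply Rmult_le_pos; lra.
    - intros t Ht. unfold Rem. rewrite !Cmod_mult, !Cmod_inv, !Cmod_pow.
      2: now apply Cneq_sub, Hz. 2: now apply Cpow_nz, H0.
      specialize (Hmt t Ht).
      assert (Hmp : (0 < m ^ n)%R) by (apply pow_lt; lra).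
      apply Rmult_le_compat; auto using Cmod_ge_0.
      + apply Rmult_le_pos. apply pow_le, Cmod_ge_0. apply Rmult_le_pos; apply Rlt_le, Rinv_0_lt_compat.
        apply pow_lt. lra. apply Cmod_sub_pos. now apply Hz.
      + rewrite <- Rmult_assoc. apply Rmult_le_compat.
        * apply Rmult_le_pos. apply pow_le, Cmod_ge_0. apply Rlt_le, Rinv_0_lt_compat, pow_lt. lra.
        * apply Rlt_le, Rinv_0_lt_compat. apply Cmod_sub_pos. now apply Hz.
        * unfold q, Rdiv. rewrite Rpow_mult_distr, pow_inv.
          apply Rmult_le_compat_l. apply pow_le, Cmod_ge_0.
          apply Rinv_le_contravar. exact Hmp. apply pow_incr. lra.
        * apply Rinv_le_contravar. lra. generalize (Cmod_sub_ge (gamma t) z). lra. }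
  set (A := (Cmod ka * (L * (M * / (m - Cmod z))))%R).
  assert (HA : (0 <= A)%R).
  { unfold A. repeat apply Rmult_le_pos; auto using Cmod_ge_0. apply Rlt_le, Rinv_0_lt_compat. lra. }
  intros eps He.
  (* The remainder is at most [A * q ^ S n]; the summand 1 avoids dividing by zero when [A = 0]. *)
  assert (Hp : (0 < eps / (A + 1))%R) by (apply Rdiv_lt_0_compat; lra).
  destruct (pow_lt_1_zero q ltac:(rewrite Rabs_pos_eq; lra) _ Hp) as [N HN].
  exists N. intros n Hn. rewrite Hsum.
  replace (cauchy_transform f gamma z - ka * contour_integral (Rem (S n)) gamma
    - cauchy_transform f gamma z) with (- (ka * contour_integral (Rem (S n)) gamma)) by ring.
  rewrite Cmod_opp, Cmod_mult.
  specialize (HN (S n) ltac:(lia)). rewrite Rabs_pos_eq in HN by now apply pow_le.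
  assert (Hqn : (0 <= q ^ S n)%R) by now apply pow_le.
  apply Rle_lt_trans with (A * q ^ S n)%R.
  - apply Rle_trans with (Cmod ka * (L * (M * (q ^ S n * / (m - Cmod z)))))%R.
    apply Rmult_le_compat_l. apply Cmod_ge_0. apply Hbound.
    right. unfold A. ring.
  - apply Rle_lt_trans with ((A + 1) * q ^ S n)%R. nra.
    apply (Rmult_lt_compat_l (A + 1)) in HN; [|lra].
    replace ((A + 1) * (eps / (A + 1)))%R with eps in HN by (field; lra). exact HN.
Qed.

End Main.

Theorem lemma1
  (f : C -> C) (hf : meromorphic f)
  (o : C -> nat) (a : C -> nat -> C)
  (hoa : forall p : C, is_pole f p -> pole_data f p (o p) (a p))
  (Omega : C -> Prop)
  (hopen : open (T := C_UniformSpace) Omega)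
  (hsc : simply_connected Omega)
  (gamma : R -> C) (hgamma : bounds_ccw gamma Omega)
  (hbd : forall w : C, boundary Omega w -> ~ is_pole f w)
  (poles : list C) (hnodup : NoDup poles)
  (hpoles : forall p : C, In p poles <-> is_pole f p /\ Omega p) :
  (forall z : C, Omega z -> ~ is_pole f z ->
     f z = sum_over (fun p => principal_part (o p) (a p) p z) poles
           + cauchy_transform f gamma z) /\
  (forall (m : R) (z : C), is_min_modulus (boundary Omega) m ->
     (Cmod z < m)%R ->
     is_series (K := C_AbsRing) (V := C_NormedModule)
       (fun j : nat => z ^ j *
          (/ (2 * PI * Ci) * contour_integral (fun w => f w / w ^ (j + 1)) gamma))
       (cauchy_transform f gamma z)).
Proof.
  split.
  - intros z Hz Hnz.
    rewrite (cauchy_formula_residual f hf o a hoa Omega hopen gamma hgamma hbd poles hnodup hpoles z Hz Hnz).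
    ring.
  - intros m z [_ Hm] Hzm.
    exact (cauchy_transform_expansion f hf Omega gamma hgamma hbd m z Hm Hzm).
Qed.
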